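(* Let $\alpha>0$ be fixed. Let $\Omega\colon\mathbb{R}\to\mathbb{R}_+$ be a continual diagram and let $a<a_0<b_0<b$ be real numbers such that: (i) the restriction of $\Omega$ to $[a,b]$ is $(1-\delta)$-Lipschitz for some constant $\delta>0$; (ii) the restriction of the transition measure $\mu_\Omega$ to $[a,b]$ is absolutely continuous with a density bounded from above by some constant. Let $(\omega_n)_{n\ge 1}$ be a sequence of continual diagrams such that \[ d(\Omega,\omega_n)=o\left(\frac{1}{n^{\alpha}\log n}\right) \quad (n\to\infty).\] Then \[ \sup_{z\in[a_0,b_0]}\big|K_{\omega_n}(z)-K_{\Omega}(z)\big| = o\left(\frac{1}{n^{\alpha}}\right).\]
   Context: A continual diagram is a function $\omega\colon\mathbb{R}\to\mathbb{R}_+$ such that $|\omega(z_1)-\omega(z_2)|\le|z_1-z_2|$ for all $z_1,z_2\in\mathbb{R}$, and $\omega(z)=|z|$ for all sufficiently large $|z|$. Transition measure: for a continual diagram $\omega$, its Cauchy transform $\mathbf{G}_\omega$ is defined for $z\in\mathbb{C}\setminus\mathbb{R}$ by \[\log\big[z\,\mathbf{G}_\omega(z)\big]=-\int_{-\infty}^{\infty}\frac{1}{z-w}\left(\frac{\omega(w)-|w|}{2}\right)'\,dw,\] and the transition measure $\mu_\omega$ is the unique (compactly supported) probability measure on $\mathbb{R}$ with $\mathbf{G}_\omega(z)=\int\frac{1}{z-x}\,d\mu_\omega(x)$ (obtained by Stieltjes inversion). (For a piecewise affine $\omega$ with slopes $\pm1$, local minima at $\mathbbm{x}_0<\dots<\mathbbm{x}_L$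 and local maxima at $\mathbbm{y}_1<\dots<\mathbbm{y}_L$, this gives $\mathbf{G}_\omega(z)=\prod_{i=1}^L(z-\mathbbm{y}_i)/\prod_{i=0}^L(z-\mathbbm{x}_i)$.) The cumulative function is $K_\omega(z)=\mu_\omega((-\infty,z])$. Metric $d$: for $x,y\ge0$ write $(x,y)\in\omega$ if $\omega(x-y)=x+y$. For $x\ge0$ let $\Pi^\omega_Y(x)=\{y\ge 0:(x,y)\in\omega\}$ and for $y\ge0$ let $\Pi^\omega_X(y)=\{x\ge0:(x,y)\in\omega\}$ (nonempty closed sets). Define $d_Y(\omega_1,\omega_2)=\sup_{x\ge0}d_H(\Pi_Y^{\omega_1}(x),\Pi_Y^{\omega_2}(x))$, $d_X(\omega_1,\omega_2)=\sup_{y\ge0}d_H(\Pi_X^{\omega_1}(y),\Pi_X^{\omega_2}(y))$, where $d_H$ is the Hausdorff distance, and $d(\omega_1,\omega_2)=\max(d_X(\omega_1,\omega_2),d_Y(\omega_1,\omega_2))$. *)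

(* Defs.v *)
From HB Require Import structures.
From mathcomp Require Import all_boot all_order all_algebra.
From mathcomp Require Import all_classical all_reals all_analysis.
From mathcomp Require Import complex.

Set Implicit Arguments.
Unset Strict Implicit.
Unset Printing Implicit Defensive.

Import Order.TTheory GRing.Theory Num.Theory.
Import numFieldNormedType.Exports.

Local Open Scope classical_set_scope.
Local Open Scope ring_scope.

Section Diagrams.
Variable R : realType.

Definition continual_diagram (w : R -> R) : Prop :=
  (forall z, 0 <= w z) /\
  (forall z1 z2, `|w z1 - w z2| <= `|z1 - z2|) /\
  (exists M : R, forall z, M <= `|z| -> w z = `|z|).

Definition cexp (z : R[i]) : R[i] :=
  ((expR (complex.Re z))%:C * (cos (complex.Im z) +i* sin (complex.Im z)))%C.

Definition cintegral (d : measure_display) (T : measurableType d)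
  (mu : {measure set T -> \bar R}) (f : T -> R[i]) : R[i] :=
  (Rintegral mu setT (fun x => complex.Re (f x)) +i* Rintegral mu setT (fun x => complex.Im (f x)))%C.

(* Cauchy transform G_w(z), defined through
   log[z G_w(z)] = - \int 1/(z-w) ((w(u)-|u|)/2)' du, i.e.
   z G_w(z) = exp(- \int ...). *)
Definition cauchy_G (w : R -> R) (z : R[i]) : R[i] :=
  (cexp (- cintegral (@lebesgue_measure R)
      (fun u : R => (z - u%:C)^-1 *
         (derive1 (fun v : R => (w v - `|v|) / 2) u)%:C)) / z)%C.

Definition transition_measure (w : R -> R) (mu : probability R R) : Prop :=
  forall z : R[i], complex.Im z != 0 ->
    cintegral mu (fun x : R => (z - x%:C)^-1)%C = cauchy_G w z.

Definition trans_cumul (mu : probability R R) (z : R) : R :=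
  fine (mu [set x : R | x <= z]).

Definition PiY (w : R -> R) (x : R) : set R :=
  [set y : R | 0 <= y /\ w (x - y) = x + y].
Definition PiX (w : R -> R) (y : R) : set R :=
  [set x : R | 0 <= x /\ w (x - y) = x + y].

Definition dist_to_set (p : R) (B : set R) : \bar R :=
  ereal_inf [set (`|p - b|)%:E | b in B].
Definition hausdorff (A B : set R) : \bar R :=
  maxe (ereal_sup [set dist_to_set p B | p in A])
       (ereal_sup [set dist_to_set q A | q in B]).

Definition dY (w1 w2 : R -> R) : \bar R :=
  ereal_sup [set hausdorff (PiY w1 x) (PiY w2 x) | x in [set x : R | 0 <= x]].
Definition dX (w1 w2 : R -> R) : \bar R :=
  ereal_sup [set hausdorff (PiX w1 y) (PiX w2 y) | y in [set y : R | 0 <= y]].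
Definition diag_dist (w1 w2 : R -> R) : \bar R := maxe (dX w1 w2) (dY w1 w2).

End Diagrams.

(* Main.v *)
Require Import Defs.
From HB Require Import structures.
From mathcomp Require Import all_boot all_order all_algebra.
From mathcomp Require Import all_classical all_reals all_analysis.
From mathcomp Require Import measurable_realfun complex ring lra.
Import Order.TTheory GRing.Theory Num.Theory.
Import numFieldNormedType.Exports.
Local Open Scope classical_set_scope.
Local Open Scope ring_scope.

(**
Only the consequence [|omega - Omega| <= 2 eps] of [d(Omega, omega) <= eps] is
used. Integrating by parts in the definition of the Cauchy transforms,
[log (G_omega / G_Omega)] at [x0 + i y] is at most [pi eps / y] in absolute
value. By (i), the argument of [G_Omega] stays away from [0] and [- pi] above
[[a0, b0]]; by (ii), its imaginary part is bounded there; hence [G_Omega] itself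
is bounded, and so is [Im G_omega] as long as [y >= 2 pi eps].

The cumulative function is read off from
[A_mu y = \int atan ((x0 - x) / y) dmu(x)], which tends to [0] at infinity, to
[pi / 2 * (mu (x < x0) - mu (x > x0))] at [0], and whose derivative is
[- Re G (x0 + i y)]. Integrating [|Re G_omega - Re G_Omega| <= C eps / y] from
[k = 2 pi eps] to [1] gives the error [C eps log (1 / eps)]. The error made by
stopping at height [k] is controlled by the masses of the dyadic neighbourhoods
[|x - x0| < 2 ^ j k], each at most a constant times [2 ^ j k] thanks to the bound on [Im G],
which yields again [C eps log (1 / eps)]. For [eps = o(1 / (n ^ alpha log n))]
this is [o(1 / n ^ alpha)].

The a.e. differentiability of Lipschitz functions, needed to make sense of the
density in the definition of [G], comes from the Radon-Nikodym theorem applied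
to a Lebesgue-Stieltjes measure.
*)

Set Implicit Arguments.
Unset Strict Implicit.
Unset Printing Implicit Defensive.

(** * Lipschitz functions and their almost everywhere derivative *)

Section NonmeasurableIntegrand.
Context d (T : measurableType d) (R : realType).
Variable mu : {measure set T -> \bar R}.
Local Open Scope ereal_scope.

(** The integral of a nonnegative function is a supremum over the simple functions below it, and a
    larger integrand only enlarges that family; this covers nonmeasurable integrands. *)
Let ge0_le_integralT (f g : T -> \bar R) : (forall x, 0 <= f x) ->
  (forall x, f x <= g x) -> \int[mu]_x f x <= \int[mu]_x g x.
Proof.
move=> f0 fg; rewrite !ge0_integralTE//; last first.
  by move=> x; exact: le_trans (fg x).
apply: ereal_sup_le => _ [h hf <-].
by exists h => // x; exact: le_trans (hf x) (fg x).
Qed.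

(** Squeeze: [f] lies between [g1] and [g2], obtained from [g] by putting [0] and [+oo] on [N]; both
    are measurable and have the integral of [g]. *)
Let ge0_ae_integral (N : set T) (f g : T -> \bar R) :
  measurable N -> mu N = 0 -> measurable_fun setT g ->
  (forall x, 0 <= f x) -> (forall x, 0 <= g x) ->
  (forall x, ~ N x -> f x = g x) -> \int[mu]_x f x = \int[mu]_x g x.
Proof.
move=> mN N0 mg f0 g0 fg.
pose g1 x := if x \in N then 0 else g x.
pose g2 x := if x \in N then +oo else g x.
have mg1 : measurable_fun setT g1.
  apply: measurable_fun_if => //; last exact: measurable_funTS.
  by apply: (measurable_fun_bool true); rewrite setTI preimage_mem_true.
have mg2 : measurable_fun setT g2.
  apply: measurable_fun_if => //; last exact: measurable_funTS.
  by apply: (measurable_fun_bool true); rewrite setTI preimage_mem_true.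
have g10 x : 0 <= g1 x by rewrite /g1; case: ifP.
have g20 x : 0 <= g2 x by rewrite /g2; case: ifP.
have E1 : \int[mu]_x g1 x = \int[mu]_x g x.
  apply: ge0_ae_eq_integral => //; exists N; split => // x /= /not_implyP[_].
  by rewrite /g1; apply: contra_notP => xN; rewrite memNset.
have E2 : \int[mu]_x g2 x = \int[mu]_x g x.
  apply: ge0_ae_eq_integral => //; exists N; split => // x /= /not_implyP[_].
  by rewrite /g2; apply: contra_notP => xN; rewrite memNset.
apply/eqP; rewrite eq_le; apply/andP; split.
  rewrite -E2; apply: ge0_le_integralT => // x; rewrite /g2.
  by case: ifPn => [_|]; rewrite ?leey// notin_setE => /fg ->.
rewrite -E1; apply: ge0_le_integralT => // x; rewrite /g1.
by case: ifPn => [//|]; rewrite notin_setE => /fg ->.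
Qed.

(* Unlike [ae_eq_integral], no measurability of the integrand [f] is assumed. *)
Lemma ae_eq_integral_nonmeasurable (N : set T) (f g : T -> \bar R) :
  measurable N -> mu N = 0 -> measurable_fun setT g ->
  (forall x, ~ N x -> f x = g x) -> \int[mu]_x f x = \int[mu]_x g x.
Proof.
move=> mN N0 mg fg; rewrite integralE [RHS]integralE; congr (_ - _).
- apply: (ge0_ae_integral mN N0) => //; first exact: measurable_funepos.
  by move=> x Nx; rewrite !funeposE fg.
- apply: (ge0_ae_integral mN N0) => //; first exact: measurable_funeneg.
  by move=> x Nx; rewrite !funenegE fg.
Qed.

End NonmeasurableIntegrand.

Section IntegrableReal.
Context d (T : measurableType d) (R : realType).
Variables (mu : {measure set T -> \bar R}) (D : set T).
Hypothesis mD : measurable D.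
Implicit Types f g : T -> R.

Lemma integrableZl_EFin (k : R) f : mu.-integrable D (EFin \o f) ->
  mu.-integrable D (EFin \o (fun x => k * f x)).
Proof. exact: integrableZl. Qed.

Lemma integrableD_EFin f g : mu.-integrable D (EFin \o f) ->
  mu.-integrable D (EFin \o g) -> mu.-integrable D (EFin \o (fun x => f x + g x)).
Proof. exact: integrableD. Qed.

Lemma integrableB_EFin f g : mu.-integrable D (EFin \o f) ->
  mu.-integrable D (EFin \o g) -> mu.-integrable D (EFin \o (fun x => f x - g x)).
Proof. exact: integrableB. Qed.

Lemma bounded_integrable (M : R) f : (mu D < +oo)%E -> measurable_fun D f ->
  (forall x, D x -> `|f x| <= M) -> mu.-integrable D (EFin \o f).
Proof.
move=> muD mf fM; apply: measurable_bounded_integrable => //.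
exists M; split; rewrite ?num_real// => t Mt x Dx.
exact: le_trans (fM x Dx) (ltW Mt).
Qed.

End IntegrableReal.

Section LipschitzDerivative.
Context {R : realType}.
Implicit Types (f : R -> R) (a b : R).
Local Notation leb := (@lebesgue_measure R).

Lemma lebesgue_stieltjes_itv (F : cumulative R R) x y : x <= y ->
  lebesgue_stieltjes_measure F `]x, y]%classic = (F y - F x)%:E.
Proof.
move=> xy; rewrite /lebesgue_stieltjes_measure /measure_extension.
by rewrite measurable_mu_extE/= ?wlength_itv_bnd//; exact: is_ocitv.
Qed.

(** The two Stieltjes measures add up to Lebesgue measure, by uniqueness on half-open intervals;
    dropping the one of [G] leaves the inequality. *)
Lemma lebesgue_stieltjes_le (F G : cumulative R R) :
  (forall x y, F y - F x + (G y - G x) = y - x) ->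
  forall A, measurable A -> (lebesgue_stieltjes_measure F A <= leb A)%E.
Proof.
move=> FG A mA.
pose m := measure_add (lebesgue_stieltjes_measure F)
                      (lebesgue_stieltjes_measure G).
have -> : leb A = m A.
  apply: (@lebesgue_measure_unique R m) => // _ [[x y] _ <-].
  rewrite /m [RHS]measure_addE.
  have [xy|yx] := leP x y.
    rewrite [RHS](_ : _ = (F y - F x)%:E + (G y - G x)%:E)%E.
      by rewrite -EFinD FG; exact: (lebesgue_stieltjes_itv idfun).
    by congr (_ + _)%E; exact: lebesgue_stieltjes_itv.
  by rewrite set_itv_ge ?bnd_simp -?leNgt ?ltW// !measure0 adde0.
by rewrite /m measure_addE leeDl.
Qed.

(** Both [f] and [x - f x] are nondecreasing and continuous, so the Stieltjes measure of [f] is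
    dominated by Lebesgue measure; [p] is its Radon-Nikodym density. *)
Lemma density_of_slope01 f a b : a < b ->
  (forall x y, x <= y -> 0 <= f y - f x <= y - x) ->
  exists p : R -> R, leb.-integrable setT (EFin \o p) /\
    forall x, a <= x <= b -> f x - f a = \int[leb]_(t in `]a, x]) p t.
Proof.
move=> ab slope.
have lipf x y : `|f x - f y| <= `|x - y|.
  wlog xy : x y / x <= y.
    by move=> H; have [/H//|/ltW/H] := leP x y; rewrite distrC (distrC y).
  have /andP[h1 h2] := slope _ _ xy.
  by rewrite distrC (distrC x) !ger0_norm ?subr_ge0// -subr_ge0.
have cf : continuous f.
  move=> x; apply/cvgrPdist_le => e e0; apply/nbhs_ballP; exists e => // t.
  by rewrite /ball/= => /ltW; exact: le_trans (lipf x t).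
pose g x := x - f x.
have cg : continuous g by move=> x; apply: cvgB; [exact: cvg_id|exact: cf].
have ndf : nondecreasing f.
  by move=> x y /slope/andP[]; rewrite subr_ge0.
have ndg : nondecreasing g.
  by move=> x y /slope/andP[_]; rewrite /g; lra.
pose F : cumulative R R := HB.pack f
  (isCumulative.Build R _ R f ndf (right_continuousW cf)).
pose G : cumulative R R := HB.pack g
  (isCumulative.Build R _ R g ndg (right_continuousW cg)).
have FG x y : F y - F x + (G y - G x) = y - x by rewrite /F/G/= /g; ring.
pose mF := lebesgue_stieltjes_measure F.
have mab : measurable (`]a, b]%classic : set (measurableTypeR R)).
  exact: measurable_itv.
have mFab : (mF `]a, b]%classic < +oo)%E by rewrite /mF lebesgue_stieltjes_itv ?ltW// ltry.
(* Restricting to []a, b]] makes the measure finite, hence its density integrable on the whole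
   line. *)
pose nu := mfrestr mab mFab.
have nuleb : nu `<< leb.
  apply/null_content_dominatesP => A mA A0.
  apply/eqP; rewrite -measure_le0 -A0 /nu /mfrestr/= /mrestr.
  apply: (le_trans _ (lebesgue_stieltjes_le FG mA)).
  by apply: le_measure; rewrite ?inE//; exact: measurableI.
have [p [p0 pfin ip pE]] := radon_nikodym_sigma_finite nuleb.
have pfine : EFin \o (fine \o p) = p by apply/funext => x /=; rewrite fineK.
exists (fine \o p); split; first by rewrite pfine.
move=> x /andP[ax xb].
have mI := @measurable_itv R `]a, x].
rewrite /Rintegral (eq_integral p); last by move=> t _ /=; rewrite fineK.
rewrite -pE//.
rewrite [X in fine X](_ : _ = mF (`]a, x]%classic `&` `]a, b]%classic))//.
rewrite setIidl; last by apply: subset_itvl; rewrite bnd_simp.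
by rewrite /mF lebesgue_stieltjes_itv.
Qed.

Lemma is_derive_bounds f (x d u v lo hi : R) : u < x < v -> is_derive x 1 f d ->
  (forall s t, u < s -> s <= t -> t < v ->
     lo * (t - s) <= f t - f s <= hi * (t - s)) ->
  lo <= d <= hi.
Proof.
move=> /andP[ux xv] [dfx dE] slope.
have cvgf : h^-1 *: (f (h + x) - f x) @[h --> 0^'] --> d.
  have -> : (fun h => h^-1 *: (f (h + x) - f x)) =
      (fun h => h^-1 *: ((f \o shift x) (h *: (1 : R)) - f x)).
    by apply/funext => h; rewrite /= [h%:A]mulr1.
  by rewrite -dE; exact: dfx.
have near_slope : \forall h \near (0:R)^',
    lo <= h^-1 *: (f (h + x) - f x) <= hi.
  near=> h.
  have h0 : h != 0 by near: h; exact: nbhs_dnbhs_neq.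
  have hu : `|h| < Num.min (x - u) (v - x).
    by near: h; apply: dnbhs0_lt; rewrite lt_min !subr_gt0 ux.
  move: hu; rewrite lt_min !ltr_norml => /andP[/andP[h1 h2] /andP[h3 h4]].
  have hD (y : R) : h^-1 *: y = y / h by rewrite /GRing.scale/= mulrC.
  rewrite hD; case: (ltgtP h 0) h0 => // hh _.
    have /andP[] := slope (h + x) x ltac:(lra) ltac:(lra) ltac:(lra).
    rewrite ler_ndivrMr// ler_ndivlMr// => s1 s2; apply/andP; split; lra.
  have /andP[] := slope x (h + x) ltac:(lra) ltac:(lra) ltac:(lra).
  rewrite ler_pdivrMr// ler_pdivlMr// => s1 s2; apply/andP; split; lra.
apply/andP; split.
- by apply: (@cvgr_to_ge _ _ _ _ _ _ lo cvgf); apply: filterS near_slope => h /andP[].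
- by apply: (@cvgr_to_le _ _ _ _ _ _ hi cvgf); apply: filterS near_slope => h /andP[].
Unshelve. all: by end_near. Qed.

(* Any Lipschitz constant can be rescaled so that the slopes lie in [0, 1]. *)
Lemma lipschitz_derivative f (K a b : R) : 0 < K -> a < b ->
  (forall x y, `|f x - f y| <= K * `|x - y|) ->
  exists h : R -> R, [/\ measurable_fun setT h,
    forall x, `|h x| <= K,
    {ae leb, forall x, a < x < b -> is_derive x 1 f (h x)} &
    forall x, a <= x <= b -> f x - f a = \int[leb]_(t in `]a, x]) h t].
Proof.
move=> K0 ab lipf.
pose g x := (f x / K + x) / 2.
have slope x y : x <= y -> 0 <= g y - g x <= y - x.
  move=> xy; have : `|(f y - f x) / K| <= y - x.
    rewrite normrM (gtr0_norm (_ : 0 < K^-1)) ?invr_gt0// ler_pdivrMr//.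
    by rewrite mulrC (le_trans (lipf y x))// ger0_norm// subr_ge0.
  rewrite ler_norml mulrBl /g; set fx := f x / K; set fy := f y / K.
  by move=> /andP[h1 h2]; apply/andP; split; lra.
have [p [ip pE]] := density_of_slope01 ab slope.
have locp : locally_integrable setT p.
  by apply: open_integrable_locally => //; exact: openT.
have mp : measurable_fun setT p by case/integrableP : ip => /measurable_EFinP.
(* [h0] undoes the rescaling [f = K * (2 * g - id)]; clipping it to [[- K, K]] makes the bound on
   [h] hold everywhere and changes it only on a null set. *)
pose h0 x := K * (2 * p x - 1).
pose h x := Num.max (- K) (Num.min K (h0 x)).
have mh0 : measurable_fun setT h0.
  apply: measurable_funM => //; apply: measurable_funB => //.
  exact: measurable_funM.
have mh : measurable_fun setT h.
  by apply: measurable_maxr => //; exact: measurable_minr.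
have hK x : `|h x| <= K.
  rewrite ler_norml /h le_max lexx/= ge_max ge_min lexx/= andbT.
  by rewrite (le_trans _ (ltW K0))// oppr_le0 ltW.
(* At a Lebesgue point of [p] the primitive of [p], which is [g] up to a constant, has derivative
   [p x]; there the Lipschitz bound shows that clipping is inactive. *)
have der : {ae leb, forall x, a < x < b -> is_derive x 1 f (h0 x) /\ h x = h0 x}.
  move: (lebesgue_differentiation locp); apply: filterS.
    exact: (ae_filter_ringOfSetsType leb).
  move=> x px /andP[ax xb].
  have ipab : leb.-integrable [set` Interval (BRight a) (BRight b)] (EFin \o p).
    exact: integrableS ip.
  have [] := FTC1_lebesgue_pt xb ipab _ px; first by [].
  set F := (fun y => _) => dF dFE.
  have isF : is_derive x 1 F (p x) by apply: DeriveDef; rewrite -?derive1E.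
  have isf : is_derive x 1 f (h0 x).
    apply: (@near_eq_is_derive _ _ _ (fun y => K * (2 * (F y + g a) - y))).
      near=> y.
      have -> : F y + g a = g y.
        rewrite /F -pE ?subrK//; apply/andP; split.
          by near: y; apply: filterS (lt_nbhsr ax) => y /ltW.
        by near: y; apply: filterS (lt_nbhsl xb) => y /ltW.
      by rewrite /g; field; rewrite gt_eqF.
    apply: is_derive_eq.
    rewrite /h0 /GRing.scale/=; ring.
  split => //.
  have /andP[lo hi] : - K <= h0 x <= K.
    apply: (is_derive_bounds (u := a) (v := b) _ isf); first by rewrite ax.
    move=> s t _ st _; have := lipf t s.
    by rewrite (ger0_norm (_ : 0 <= t - s)) ?subr_ge0// ler_norml -mulNr.
  by rewrite /h min_r// max_r.
exists h; split => //.
  move: der; apply: filterS; first exact: (ae_filter_ringOfSetsType leb).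
  by move=> x H /H[+ ->].
move=> x /andP[ax xb].
have ipx : leb.-integrable `]a, x] (EFin \o p) by exact: integrableS ip.
have lebx : (leb `]a, x]%classic < +oo)%E.
  by rewrite /= lebesgue_measure_itv/= lte_fin; case: ifP; rewrite -?EFinD ltry.
have i1x : leb.-integrable `]a, x] (EFin \o (fun=> 1 : R)).
  by apply: (@bounded_integrable _ _ _ _ _ _ 1) => // t _; rewrite normr1.
have i2x : leb.-integrable `]a, x] (EFin \o (fun t => 2 * p t)).
  exact: integrableZl_EFin.
have i3x : leb.-integrable `]a, x] (EFin \o (fun t => 2 * p t - 1)).
  exact: integrableB_EFin.
have ih0x : leb.-integrable `]a, x] (EFin \o h0) by exact: integrableZl_EFin.
have ihx : leb.-integrable `]a, x] (EFin \o h).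
  by apply: (@bounded_integrable _ _ _ _ _ _ K) => //; exact: measurable_funTS.
transitivity (\int[leb]_(t in `]a, x]) h0 t).
  rewrite RintegralZl// RintegralB// RintegralZl// -pE ?ax// Rintegral_cst//=.
  rewrite lebesgue_measure_itv/= lte_fin /g; case: ltP => [_|xa].
    rewrite -EFinD/=; field; rewrite gt_eqF//.
  have -> : x = a by apply/eqP; rewrite eq_le ax xa.
  rewrite /=; ring.
(* The derivative is known only inside []a, b[], so the right endpoint is removed before comparing
   [h] and [h0]. *)
rewrite -Rintegral_itv_bndo_bndc; last first.
  by apply: integrableS ih0x => //; apply: subset_itvl; rewrite bnd_simp.
rewrite -[RHS]Rintegral_itv_bndo_bndc; last first.
  by apply: integrableS ihx => //; apply: subset_itvl; rewrite bnd_simp.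
congr fine; apply: ae_eq_integral => //.
- exact/measurable_EFinP/measurable_funTS.
- exact/measurable_EFinP/measurable_funTS.
- move: der; apply: filterS; first exact: (ae_filter_ringOfSetsType leb).
  move=> t H; rewrite /= in_itv/= => /andP[at_ tx].
  by have [|_ ->] := H; rewrite ?at_ ?(lt_le_trans tx).
Unshelve. all: by end_near. Qed.

End LipschitzDerivative.

(** * Integration by parts for Lipschitz functions *)

Section ByParts.
Context {R : realType}.
Local Notation leb := (@lebesgue_measure R).

Lemma is_derive_uniq (f : R -> R) (x d1 d2 : R) :
  is_derive x 1 f d1 -> is_derive x 1 f d2 -> d1 = d2.
Proof. by move=> [_ <-] [_ <-]. Qed.

Lemma lebesgue_itv_lty (a b : R) : (leb `]a, b]%classic < +oo)%E.
Proof.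
by rewrite /= lebesgue_measure_itv/= lte_fin; case: ifP; rewrite -?EFinD ltry.
Qed.

Lemma continuous_lipschitz (f : R -> R) (K : R) : 0 <= K ->
  (forall x y, `|f x - f y| <= K * `|x - y|) -> continuous f.
Proof.
move=> K0 lipf x; apply/cvgrPdist_le => e e0; apply/nbhs_ballP.
exists (e / (K + 1)); first by rewrite /= divr_gt0// ltr_wpDl.
move=> t; rewrite /ball/= ltr_pdivlMr ?ltr_wpDl// => xt.
rewrite (le_trans (lipf x t))// (le_trans _ (ltW xt))// mulrC ler_wpM2l//.
by rewrite lerDl.
Qed.

(* The product [phi * D] is Lipschitz and vanishes at both endpoints. *)
Lemma lipschitz_by_parts (phi phi' D h : R -> R) (a b B B' K M : R) :
  a < b -> 0 <= K -> 0 <= B' ->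
  (forall x : R, is_derive x 1 phi (phi' x)) ->
  (forall x, `|phi x| <= B) -> (forall x, `|phi' x| <= B') ->
  measurable_fun setT phi' ->
  (forall x y, `|phi x - phi y| <= B' * `|x - y|) ->
  (forall x y, `|D x - D y| <= K * `|x - y|) -> (forall x, `|D x| <= M) ->
  D a = 0 -> D b = 0 ->
  measurable_fun setT h -> (forall x, `|h x| <= K) ->
  {ae leb, forall x : R, a < x < b -> is_derive x 1 D (h x)} ->
  \int[leb]_(x in `]a, b]) (phi x * h x) =
  - \int[leb]_(x in `]a, b]) (phi' x * D x).
Proof.
move=> ab K0 B'0 dphi phiB phi'B mphi' lipphi lipD DM Da Db mh hK derD.
have B0 : 0 <= B by exact: le_trans (phiB 0).
have M0 : 0 <= M by exact: le_trans (DM 0).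
have mphi : measurable_fun setT phi.
  by apply: continuous_measurable_fun; exact: continuous_lipschitz lipphi.
have mD : measurable_fun setT D.
  by apply: continuous_measurable_fun; exact: continuous_lipschitz lipD.
pose g x := phi x * D x.
pose K' := B * K + B' * M + 1.
have K'0 : 0 < K' by rewrite ltr_wpDl// addr_ge0// mulr_ge0.
have lipg x y : `|g x - g y| <= K' * `|x - y|.
  have -> : g x - g y = phi x * (D x - D y) + (phi x - phi y) * D y.
    by rewrite /g; ring.
  rewrite (le_trans (ler_normD _ _))// !normrM.
  have h1 : `|phi x| * `|D x - D y| <= B * (K * `|x - y|) by exact: ler_pM.
  have h2 : `|phi x - phi y| * `|D y| <= B' * `|x - y| * M by exact: ler_pM.
  rewrite (le_trans (lerD h1 h2))// /K' !mulrDl -!mulrA (mulrC M) mul1r.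
  by rewrite lerDl.
(* The density [hg] of the product has integral zero, and almost everywhere it equals
   [phi * h + phi' * D] by uniqueness of the derivative. *)
have [hg [mhg hgK derg intg]] := lipschitz_derivative K'0 ab lipg.
have int0 : \int[leb]_(t in `]a, b]) hg t = 0.
  by rewrite -intg ?lexx ?andbT ?ltW// /g Da Db !mulr0 subrr.
have mab : measurable (`]a, b]%classic : set (measurableTypeR R)) by [].
have i1 : leb.-integrable `]a, b] (EFin \o (fun x => phi x * h x)).
  apply: (@bounded_integrable _ _ _ _ _ _ (B * K)) => //.
  - exact: lebesgue_itv_lty.
  - by apply: measurable_funTS; exact: measurable_funM.
  - by move=> x _; rewrite normrM ler_pM.
have i2 : leb.-integrable `]a, b] (EFin \o (fun x => phi' x * D x)).
  apply: (@bounded_integrable _ _ _ _ _ _ (B' * M)) => //.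
  - exact: lebesgue_itv_lty.
  - by apply: measurable_funTS; exact: measurable_funM.
  - by move=> x _; rewrite normrM ler_pM.
have ig : leb.-integrable `]a, b] (EFin \o hg).
  apply: (@bounded_integrable _ _ _ _ _ _ K') => //.
  - exact: lebesgue_itv_lty.
  - exact: measurable_funTS.
apply/eqP; rewrite -addr_eq0 -RintegralD//; apply/eqP; rewrite -[RHS]int0.
have sub : `]a, b[ `<=` `]a, b].
  by apply: subset_itvl; rewrite bnd_simp.
rewrite -Rintegral_itv_bndo_bndc; last first.
  by apply: integrableS (integrableD_EFin mab i1 i2).
rewrite -[RHS]Rintegral_itv_bndo_bndc; last exact: integrableS ig.
congr fine; apply: ae_eq_integral => //.
- apply/measurable_EFinP/measurable_funTS.
  by apply: measurable_funD; exact: measurable_funM.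
- exact/measurable_EFinP/measurable_funTS.
- move: derD derg; apply: filterS2; first exact: (ae_filter_ringOfSetsType leb).
  move=> t HD Hg; rewrite /= in_itv/= => tab; congr EFin.
  apply: is_derive_uniq (Hg tab).
  have := HD tab => dD.
  have -> : g = phi * D by [].
  by apply: is_derive_eq; rewrite /GRing.scale/= (mulrC (D t)).
Qed.

End ByParts.

(** * The density in the exponent of the Cauchy transform *)

Section DiagramDensity.
Context {R : realType}.
Local Notation leb := (@lebesgue_measure R).
Implicit Types w : R -> R.

Definition hump w (v : R) := (w v - `|v|) / 2.

Lemma hump_lipschitz w x y : continual_diagram w ->
  `|hump w x - hump w y| <= 1 * `|x - y|.
Proof.
move=> [_ [lipw _]]; rewrite mul1r /hump -mulrBl normrM.
rewrite [X in _ * X]gtr0_norm ?invr_gt0// ler_pdivrMr//.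
have -> : w x - `|x| - (w y - `|y|) = (w x - w y) - (`|x| - `|y|) by ring.
rewrite (le_trans (ler_normB _ _))// mulr_natr mulr2n lerD//.
exact: ler_dist_dist.
Qed.

(** [derive1] takes a default value where [hump w] is not differentiable. A bounded measurable [h]
    replaces it: the two agree almost everywhere on []- L, L[], and outside [[- L, L]] the hump
    vanishes locally. *)
Lemma hump_density w (L : R) : continual_diagram w -> 0 < L ->
  (forall z, L <= `|z| -> w z = `|z|) ->
  exists h : R -> R, [/\ measurable_fun setT h,
    forall x, `|h x| <= 1,
    {ae leb, forall x : R, - L < x < L -> is_derive x 1 (hump w) (h x)} &
    forall phi : R -> R, measurable_fun setT phi ->
      \int[leb]_x (phi x * derive1 (hump w) x) =
      \int[leb]_(x in `](- L), L]) (phi x * h x)].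
Proof.
move=> cw L0 wL.
have LL : - L < L by lra.
have [h [mh h1 derh _]] := lipschitz_derivative ltr01 LL (fun x y => hump_lipschitz x y cw).
have out (x : R) : L < `|x| -> derive1 (hump w) x = 0.
  move=> xL.
  have d0 : is_derive x 1 (hump w) 0.
    apply: (@near_eq_is_derive _ _ _ (cst (0 : R))).
    near=> y; rewrite /hump wL ?subrr ?mul0r//; apply/ltW; near: y.
    apply: (@cvgr_gt _ _ _ _ (fun y => `|y|) `|x|) => //.
    exact: norm_continuous.
  by rewrite derive1E derive_val.
exists h; split => // phi mphi.
rewrite [RHS]Rintegral_mkcond; congr fine.
have [N [mN N0 subN]] := derh.
(* At the endpoints neither the local vanishing nor the statement on the open interval applies; they
   are put into the null set. *)
pose E : set (measurableTypeR R) := [set - L] `|` [set L].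
have m1 r : measurable ([set r] : set (measurableTypeR R)).
  exact: (@measurable_set1 R r).
have mE : measurable E by apply: measurableU; exact: m1.
have E0 : leb E = 0%E.
  apply: (@null_set_setU _ _ _ leb); [exact: m1|exact: m1|exact: lebesgue_measure_set1..].
pose N' := N `|` E.
apply: (@ae_eq_integral_nonmeasurable _ _ _ _ N').
- exact: measurableU.
- by rewrite measureU0.
- apply/measurable_EFinP; apply/(measurable_restrictT _ _).1 => //.
  by apply: measurable_funTS; exact: measurable_funM.
- move=> x; rewrite /N' /= !not_orP => -[xN [xNL xL]]; congr EFin.
  rewrite patchE; case: ifPn => [|xout].
    rewrite inE/= in_itv/= => /andP[x1 x2].
    have dx : is_derive x 1 (hump w) (h x).
      apply: contrapT => ndx; apply: xN; apply: subN => /= H; apply: ndx.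
      by apply: H; rewrite x1 lt_neqAle x2 andbT; exact/eqP.
    by rewrite derive1E derive_val.
  suff -> : derive1 (hump w) x = 0 by rewrite mulr0.
  have xL' : L < `|x|.
    move: xout; rewrite notin_setE/= in_itv/= => /negP; rewrite negb_and -!leNgt -ltNge.
    move=> /orP[xl|xl]; last exact: lt_le_trans (ler_norm x).
    rewrite -normrN; apply: lt_le_trans (ler_norm _).
    rewrite ltrNr lt_neqAle xl andbT; exact/eqP.
  exact: out.
Unshelve. all: by end_near. Qed.

End DiagramDensity.

(** * Cauchy transform of a diagram in polar form *)

Section HumpSlope.
Context {R : realType}.

(** On either side of [0] the quantity [(x < 0) - d] is [(1 - w' x) / 2]. The interval is cut at [0]
    so that the absolute value in [hump] is linear on it. *)
Lemma hump_derive_bounds (w : R -> R) (c u v x d : R) :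
  (forall s t : R, u < s < v -> u < t < v -> `|w s - w t| <= c * `|s - t|) ->
  u < x < v -> x != 0 -> is_derive x 1 (hump w) d ->
  (1 - c) / 2 <= (x < 0)%R%:R - d <= (1 + c) / 2.
Proof.
move=> lipw /andP[ux xv] x0 dx.
have slope s t : u < s -> s <= t -> t < v ->
    - c * (t - s) <= w t - w s <= c * (t - s).
  move=> us st tv; have := lipw t s.
  rewrite us tv (lt_le_trans us) ?(le_lt_trans st)// => /(_ erefl erefl).
  by rewrite (ger0_norm (_ : 0 <= t - s)) ?subr_ge0// ler_norml -mulNr.
case: (ltgtP x 0) x0 => // xs _.
- have /andP[] : (1 - c) / 2 <= d <= (1 + c) / 2.
    apply: (is_derive_bounds (u := u) (v := Num.min v 0) _ dx).
      by rewrite ux lt_min xv.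
    move=> s t us st; rewrite lt_min => /andP[tv t0].
    have /andP[h1 h2] := slope _ _ us st tv.
    rewrite /hump !ler0_norm; [|lra..].
    by apply/andP; split; lra.
  by rewrite mulr1n => h1 h2; apply/andP; split; lra.
- have /andP[] : - ((1 + c) / 2) <= d <= - ((1 - c) / 2).
    apply: (is_derive_bounds (u := Num.max u 0) (v := v) _ dx).
      by rewrite xv andbT gt_max ux.
    move=> s t; rewrite gt_max => /andP[us s0] st tv.
    have /andP[h1 h2] := slope _ _ us st tv.
    rewrite /hump !ger0_norm; [|lra..].
    by apply/andP; split; lra.
  by rewrite mulr0n => h1 h2; apply/andP; split; lra.
Qed.

End HumpSlope.

(** * The Poisson kernel and its conjugate, without the factor [1 / pi] *)

Section Kernels.
Context {R : realType}.
Local Notation leb := (@lebesgue_measure R).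

(* 1 / (s + i y) = re_ker y s - i * im_ker y s *)
Definition re_ker (y s : R) := s / (s ^+ 2 + y ^+ 2).
Definition im_ker (y s : R) := y / (s ^+ 2 + y ^+ 2).

Lemma ker_denom_gt0 (y s : R) : 0 < y -> 0 < s ^+ 2 + y ^+ 2.
Proof. by move=> y0; rewrite ltr_wpDl ?sqr_ge0// exprn_gt0. Qed.

Lemma im_ker_gt0 (y s : R) : 0 < y -> 0 < im_ker y s.
Proof. by move=> y0; rewrite divr_gt0// ker_denom_gt0. Qed.

Lemma im_ker_le (y s : R) : 0 < y -> im_ker y s <= y^-1.
Proof.
move=> y0; rewrite /im_ker ler_pdivrMr ?ker_denom_gt0// -ler_pdivrMl ?invr_gt0//.
by rewrite invrK -expr2 lerDr sqr_ge0.
Qed.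

Lemma norm_re_ker_le (y s : R) : 0 < y -> `|re_ker y s| <= y^-1.
Proof.
move=> y0; have d0 := ker_denom_gt0 s y0.
rewrite /re_ker normrM normfV (gtr0_norm d0) ler_pdivrMr// -ler_pdivrMl ?invr_gt0//.
rewrite invrK -subr_ge0 -real_normK ?num_real//.
have : 0 <= (`|s| - y) ^+ 2 by exact: sqr_ge0.
have : 0 <= `|s| ^+ 2 by exact: sqr_ge0.
have : 0 <= y ^+ 2 by exact: sqr_ge0.
by rewrite sqrrB; lra.
Qed.

Definition re_ker' (y s : R) := (y ^+ 2 - s ^+ 2) / (s ^+ 2 + y ^+ 2) ^+ 2.
Definition im_ker' (y s : R) := - (2 * s * y) / (s ^+ 2 + y ^+ 2) ^+ 2.

Lemma is_derive_ker_denom (y s : R) :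
  is_derive s 1 (fun s : R => s ^+ 2 + y ^+ 2) (2 * s).
Proof. by apply: is_derive_eq; rewrite /GRing.scale/=; ring. Qed.

Lemma is_derive_re_ker (y s : R) : 0 < y -> is_derive s 1 (re_ker y) (re_ker' y s).
Proof.
move=> y0; have dn : s ^+ 2 + y ^+ 2 != 0 by rewrite gt_eqF// ker_denom_gt0.
have dd := is_deriveV (f := fun s : R => s ^+ 2 + y ^+ 2) dn (is_derive_ker_denom y s).
have -> : re_ker y = id * (fun s : R => (s ^+ 2 + y ^+ 2)^-1) by [].
by apply: is_derive_eq; rewrite /re_ker' /GRing.scale/=; field.
Qed.

Lemma is_derive_im_ker (y s : R) : 0 < y -> is_derive s 1 (im_ker y) (im_ker' y s).
Proof.
move=> y0; have dn : s ^+ 2 + y ^+ 2 != 0 by rewrite gt_eqF// ker_denom_gt0.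
have dd := is_deriveV (f := fun s : R => s ^+ 2 + y ^+ 2) dn (is_derive_ker_denom y s).
have -> : im_ker y = cst y * (fun s : R => (s ^+ 2 + y ^+ 2)^-1) by [].
by apply: is_derive_eq; rewrite /im_ker' /GRing.scale/=; field.
Qed.

(** [re_ker' - i * im_ker'] is the derivative [- (s + i y) ^ -2] of the Cauchy kernel, whose modulus
    [1 / (s ^ 2 + y ^ 2)] is [im_ker y s / y]. *)
Lemma norm_re_ker'_le (y s : R) : 0 < y -> `|re_ker' y s| <= im_ker y s / y.
Proof.
move=> y0; have d0 := ker_denom_gt0 s y0.
have -> : im_ker y s / y = (s ^+ 2 + y ^+ 2) / (s ^+ 2 + y ^+ 2) ^+ 2.
  by rewrite /im_ker; field; rewrite !gt_eqF.
rewrite /re_ker' normrM normfV [X in _ * X^-1]gtr0_norm ?exprn_gt0//.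
rewrite ler_pM2r ?invr_gt0 ?exprn_gt0// ler_norml.
by have := sqr_ge0 s; have := sqr_ge0 y; lra.
Qed.

Lemma norm_im_ker'_le (y s : R) : 0 < y -> `|im_ker' y s| <= im_ker y s / y.
Proof.
move=> y0; have d0 := ker_denom_gt0 s y0.
have -> : im_ker y s / y = (s ^+ 2 + y ^+ 2) / (s ^+ 2 + y ^+ 2) ^+ 2.
  by rewrite /im_ker; field; rewrite !gt_eqF.
rewrite /im_ker' normrM normfV [X in _ * X^-1]gtr0_norm ?exprn_gt0//.
rewrite ler_pM2r ?invr_gt0 ?exprn_gt0// normrN ler_norml.
have := sqr_ge0 (s - y); have := sqr_ge0 (s + y).
by rewrite sqrrB sqrrD; lra.
Qed.

Lemma im_ker_div_le (y s : R) : 0 < y -> im_ker y s / y <= y ^- 2.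
Proof.
move=> y0; rewrite -exprVn expr2 ler_pM2r ?invr_gt0//; exact: im_ker_le.
Qed.

Lemma is_derive_le_lipschitz (f f' : R -> R) (K : R) :
  (forall x : R, is_derive x 1 f (f' x)) -> (forall x, `|f' x| <= K) ->
  forall x y, `|f x - f y| <= K * `|x - y|.
Proof.
move=> df fK x y; wlog xy : x y / x < y.
  move=> H; case: (ltgtP x y) => [/H//|/H|->].
    by rewrite distrC (distrC y).
  by rewrite !subrr normr0 mulr0.
have cf : {within `[x, y], continuous f}.
  apply: derivable_within_continuous => z _.
  by have [] := df z.
have [z _ fyx] := MVT xy (fun z _ => df z) cf.
by rewrite distrC fyx normrM distrC ler_wpM2r.
Qed.

Lemma is_derive_atan_ker (x0 y u : R) : 0 < y ->
  is_derive u 1 (fun u : R => - atan ((x0 - u) / y)) (im_ker y (x0 - u)).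
Proof.
move=> y0; have yn : y != 0 by rewrite gt_eqF.
have d1 : is_derive u 1 (fun u : R => (x0 - u) / y) (- y^-1).
  by apply: is_derive_eq; rewrite /GRing.scale/=; ring.
have d2 := is_derive1_comp (g := fun u : R => (x0 - u) / y)
  (is_derive1_atan ((x0 - u) / y)) d1.
have -> : (fun u : R => - atan ((x0 - u) / y)) = - (atan \o (fun u : R => (x0 - u) / y)).
  by [].
apply: is_derive_eq; rewrite /im_ker; field; rewrite yn/=.
have := ker_denom_gt0 (x0 - u) y0.
by rewrite addrC => /gt_eqF ->.
Qed.

Lemma continuous_im_ker (x0 y : R) : 0 < y -> continuous (fun u : R => im_ker y (x0 - u)).
Proof.
move=> y0 u.
apply: (@continuous_comp _ _ _ (fun u : R => x0 - u) (im_ker y)).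
  by apply: cvgB; [exact: cvg_cst|exact: cvg_id].
apply/differentiable_continuous/derivable1_diffP.
by have [] := is_derive_im_ker (x0 - u) y0.
Qed.

Lemma continuous_re_ker (x0 y : R) : 0 < y -> continuous (fun u : R => re_ker y (x0 - u)).
Proof.
move=> y0 u.
apply: (@continuous_comp _ _ _ (fun u : R => x0 - u) (re_ker y)).
  by apply: cvgB; [exact: cvg_cst|exact: cvg_id].
apply/differentiable_continuous/derivable1_diffP.
by have [] := is_derive_re_ker (x0 - u) y0.
Qed.

Lemma integral_im_ker (x0 y s t : R) : 0 < y -> s <= t ->
  \int[leb]_(u in `]s, t]) im_ker y (x0 - u) =
  atan ((x0 - s) / y) - atan ((x0 - t) / y).
Proof.
move=> y0; rewrite le_eqVlt => /predU1P[->|st].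
  by rewrite subrr set_itvoc0 Rintegral_set0.
rewrite Rintegral_itv_obnd_cbnd; last first.
  apply: (@bounded_integrable _ _ _ _ _ _ y^-1) => //.
  - exact: lebesgue_itv_lty.
  - apply: measurable_funTS; apply: continuous_measurable_fun.
    exact: continuous_im_ker.
  - by move=> u _; rewrite ger0_norm ?im_ker_le// ltW// im_ker_gt0.
rewrite /Rintegral.
pose F u := - atan ((x0 - u) / y).
have dF u := is_derive_atan_ker x0 u y0.
rewrite (@continuous_FTC2 _ (fun u : R => im_ker y (x0 - u)) F)//=.
- by rewrite /F; ring.
- exact/continuous_subspaceT/continuous_im_ker.
- split.
  + by move=> u _; have [] := dF u.
  + apply: cvg_at_right_filter; apply/differentiable_continuous/derivable1_diffP.
    by have [] := dF s.
  + apply: cvg_at_left_filter; apply/differentiable_continuous/derivable1_diffP.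
    by have [] := dF t.
- by move=> u _; rewrite derive1E derive_val.
Qed.

End Kernels.

(** * Modulus and angle of the Cauchy transform; bounds on the angle *)

Section Polar.
Context {R : realType}.
Local Notation leb := (@lebesgue_measure R).

Definition is_hump_density (w : R -> R) (L : R) (h : R -> R) : Prop :=
  [/\ measurable_fun setT h,
    forall x, `|h x| <= 1,
    {ae leb, forall x : R, - L < x < L -> is_derive x 1 (hump w) (h x)} &
    forall phi : R -> R, measurable_fun setT phi ->
      \int[leb]_x (phi x * derive1 (hump w) x) =
      \int[leb]_(x in `](- L), L]) (phi x * h x)].

(** At [z = x0 + i y] the exponent in [cauchy_G], that is [log (z * G z)], equals
    [- re_log + i * im_log]. *)
Definition re_log (L : R) (h : R -> R) (x0 y : R) :=
  \int[leb]_(u in `](- L), L]) (re_ker y (x0 - u) * h u).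
Definition im_log (L : R) (h : R -> R) (x0 y : R) :=
  \int[leb]_(u in `](- L), L]) (im_ker y (x0 - u) * h u).

(* G (x0 + i y) = cauchy_mod * exp (- i * cauchy_angle) *)
Definition cauchy_mod L h (x0 y : R) :=
  expR (- re_log L h x0 y) / Num.sqrt (x0 ^+ 2 + y ^+ 2).
Definition cauchy_angle L h (x0 y : R) :=
  pi / 2 - atan (x0 / y) - im_log L h x0 y.

Lemma measurable_re_ker (x0 y : R) : 0 < y ->
  measurable_fun setT (fun u : R => re_ker y (x0 - u)).
Proof. by move=> y0; apply: continuous_measurable_fun; exact: continuous_re_ker. Qed.

Lemma measurable_im_ker (x0 y : R) : 0 < y ->
  measurable_fun setT (fun u : R => im_ker y (x0 - u)).
Proof. by move=> y0; apply: continuous_measurable_fun; exact: continuous_im_ker. Qed.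

Lemma invc_sub (x0 y u : R) :
  ((x0 +i* y - u%:C)^-1 = re_ker y (x0 - u) +i* - im_ker y (x0 - u))%C.
Proof. by rewrite /re_ker /im_ker; simpc. Qed.

Lemma transition_polar w (mu : probability R R) L h (x0 y : R) :
  transition_measure w mu -> is_hump_density w L h -> 0 < y ->
  \int[mu]_x re_ker y (x0 - x) = cauchy_mod L h x0 y * cos (cauchy_angle L h x0 y) /\
  \int[mu]_x im_ker y (x0 - x) = cauchy_mod L h x0 y * sin (cauchy_angle L h x0 y).
Proof.
move=> tw [mh h1 _ hphi] y0.
have muT : (mu setT < +oo)%E by rewrite probability_setT ltry.
have iim : mu.-integrable setT (EFin \o (fun x => im_ker y (x0 - x))).
  apply: (@bounded_integrable _ _ _ _ _ _ y^-1) => //.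
  - exact: measurable_im_ker.
  - by move=> u _; rewrite ger0_norm ?im_ker_le// ltW// im_ker_gt0.
have := tw (x0 +i* y)%C; rewrite /= gt_eqF// => /(_ isT).
rewrite /cauchy_G /cintegral.
under eq_Rintegral do rewrite invc_sub /=.
under [X in (_ +i* X)%C = _]eq_Rintegral do rewrite invc_sub /= -mulN1r.
rewrite RintegralZl// mulN1r.
have -> : \int[leb]_u complex.Re ((x0 +i* y - u%:C)^-1 *
    (derive1 (fun v : R => (w v - `|v|) / 2) u)%:C)%C = re_log L h x0 y.
  rewrite /re_log -hphi; last exact: measurable_re_ker.
  by apply: eq_Rintegral => u _; rewrite invc_sub /= mulr0 subr0.
have -> : \int[leb]_u complex.Im ((x0 +i* y - u%:C)^-1 *
    (derive1 (fun v : R => (w v - `|v|) / 2) u)%:C)%C = - im_log L h x0 y.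
  have mN : measurable_fun setT (fun u : R => - im_ker y (x0 - u)).
    by apply: measurableT_comp => //; exact: measurable_im_ker.
  rewrite /im_log -mulN1r -RintegralZl//; last first.
    apply: (@bounded_integrable _ _ _ _ _ _ (y^-1 * 1)) => //.
    - exact: lebesgue_itv_lty.
    - apply: measurable_funTS; apply: measurable_funM => //.
      exact: measurable_im_ker.
    - move=> u _; rewrite normrM ler_pM// ger0_norm ?im_ker_le//.
      by rewrite ltW// im_ker_gt0.
  transitivity (\int[leb]_u (- im_ker y (x0 - u) * derive1 (hump w) u)).
    by apply: eq_Rintegral => u _; rewrite invc_sub /= mulr0 add0r.
  by rewrite hphi//; apply: eq_Rintegral => u _; rewrite mulN1r mulNr.
set Gr := \int[mu]_x _; set Gi := \int[mu]_x _.
rewrite /cauchy_mod /cauchy_angle.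
set A := re_log _ _ _ _; set B := im_log _ _ _ _.
rewrite /cexp /= opprK; set e := expR (- A).
have d0 := ker_denom_gt0 x0 y0.
(* Polar form of the divisor [z = x0 + i y]: modulus [rho], argument [pi / 2 - atan (x0 / y)] since
   [y > 0]. *)
pose rho := Num.sqrt (x0 ^+ 2 + y ^+ 2).
have rho0 : 0 < rho by rewrite sqrtr_gt0.
have rho2 : rho ^+ 2 = x0 ^+ 2 + y ^+ 2 by rewrite sqr_sqrtr// ltW.
have sq : Num.sqrt (1 + (x0 / y) ^+ 2) = rho / y.
  have -> : 1 + (x0 / y) ^+ 2 = (rho / y) ^+ 2.
    by rewrite !expr_div_n rho2; field; rewrite gt_eqF.
  by rewrite sqrtr_sqr ger0_norm// divr_ge0// ltW.
have cosa : cos (atan (x0 / y)) = y / rho.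
  by rewrite cos_atan sq invf_div.
have cosT : cos (pi / 2 - atan (x0 / y)) = x0 / rho.
  rewrite cosB cos_pihalf sin_pihalf mul0r add0r mul1r.
  have := atanK (x0 / y); rewrite /tan cosa => /(congr1 (fun t => t * (y / rho))).
  have yrho : y / rho != 0 by rewrite mulf_neq0 ?invr_neq0// gt_eqF.
  by rewrite divfK// => ->; rewrite mulrA divfK// gt_eqF.
have sinT : sin (pi / 2 - atan (x0 / y)) = y / rho.
  by rewrite sinB cos_pihalf sin_pihalf mul0r subr0 mul1r.
rewrite -/rho; move: (pi / 2 - atan (x0 / y)) cosT sinT => t cosT sinT.
simpc => -[GrE GiE].
rewrite cosB sinB cosT sinT.
split.
  rewrite GrE -rho2; field; rewrite gt_eqF//.
move/(congr1 -%R): GiE; rewrite opprK => ->.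
rewrite -rho2; field; rewrite gt_eqF//.
Qed.

(** Almost everywhere on [D] the difference [g - f] coincides with its absolute value, whose
    integral is nonnegative. *)
Lemma ae_le_Rintegral (D : set (measurableTypeR R)) (f g : R -> R) :
  measurable D ->
  leb.-integrable D (EFin \o f) -> leb.-integrable D (EFin \o g) ->
  {ae leb, forall x, D x -> f x <= g x} ->
  \int[leb]_(x in D) f x <= \int[leb]_(x in D) g x.
Proof.
move=> mD intf intg fg; rewrite -subr_ge0 -RintegralB//.
have mf : measurable_fun D f by case/integrableP : intf => /measurable_EFinP.
have mg : measurable_fun D g by case/integrableP : intg => /measurable_EFinP.
rewrite [leRHS](_ : _ = \int[leb]_(x in D) `|g x - f x|); first exact: Rintegral_ge0.
congr fine; apply: ae_eq_integral => //.
- by apply/measurable_EFinP; exact: measurable_funB.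
- by apply/measurable_EFinP; apply: measurableT_comp => //; exact: measurable_funB.
- case: fg => N [mN N0 sub]; exists N; split => // x /= nfg.
  apply: sub => /= fg; apply: nfg => Dx.
  by rewrite ger0_norm// subr_ge0 fg.
Qed.

Lemma ae_neq (r : R) : {ae leb, forall x : R, x != r}.
Proof.
exists ([set r] : set (measurableTypeR R)); split.
- exact: (@measurable_set1 R r).
- exact: lebesgue_measure_set1.
- by move=> x /= /negP; rewrite negbK => /eqP.
Qed.

Lemma integrable_im_ker_mul (k : R -> R) (M x0 y s t : R) : 0 < y ->
  measurable_fun setT k -> (forall x, `|k x| <= M) ->
  leb.-integrable `]s, t] (EFin \o (fun u => im_ker y (x0 - u) * k u)).
Proof.
move=> y0 mk kM; apply: (@bounded_integrable _ _ _ _ _ _ (y^-1 * M)) => //.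
- exact: lebesgue_itv_lty.
- by apply: measurable_funTS; apply: measurable_funM => //; exact: measurable_im_ker.
- move=> u _; rewrite normrM ler_pM// ger0_norm ?im_ker_le//.
  by rewrite ltW// im_ker_gt0.
Qed.

Lemma integrable_im_ker (x0 y s t : R) : 0 < y ->
  leb.-integrable `]s, t] (EFin \o (fun u => im_ker y (x0 - u))).
Proof.
move=> y0.
have -> : (EFin \o (fun u => im_ker y (x0 - u))) =
          (EFin \o (fun u => im_ker y (x0 - u) * 1)).
  by apply/funext => u /=; rewrite mulr1.
by apply: (integrable_im_ker_mul (M := 1)) => // x; rewrite normr1.
Qed.

(** Replace [k] by [c] on []a, b]] and by [0] elsewhere; the remaining integral of the kernel over
    []a, b]] is the difference of arctangents. *)
Lemma poisson_lower_bound (k : R -> R) (L M x0 y a b c : R) : 0 < y ->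
  measurable_fun setT k -> (forall x, `|k x| <= M) ->
  - L <= a -> a <= b -> b <= L ->
  {ae leb, forall u : R, - L < u < L -> 0 <= k u /\ (a < u < b -> c <= k u)} ->
  c * (atan ((x0 - a) / y) - atan ((x0 - b) / y)) <=
  \int[leb]_(u in `](- L), L]) (im_ker y (x0 - u) * k u).
Proof.
move=> y0 mk kM La ab bL kae.
have iP s t : leb.-integrable `]s, t] (EFin \o (fun u => im_ker y (x0 - u))).
  exact: integrable_im_ker.
rewrite -integral_im_ker// -RintegralZl//.
have sub : `]a, b] `<=` `](- L), L].
  by apply: subset_itv; rewrite bnd_simp.
rewrite -(setIidr sub) Rintegral_mkcondr.
have mres : measurable_fun setT
    ((fun u => c * im_ker y (x0 - u)) \_ `]a, b]).
  apply/(measurable_restrictT _ _).1 => //; apply: measurable_funTS.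
  by apply: measurable_funM => //; exact: measurable_im_ker.
apply: ae_le_Rintegral => //.
- apply: (@bounded_integrable _ _ _ _ _ _ (`|c| * y^-1)) => //.
  + exact: lebesgue_itv_lty.
  + exact: measurable_funTS.
  + move=> u _; rewrite patchE; case: ifPn => _; last first.
      by rewrite normr0 mulr_ge0// invr_ge0 ltW.
    rewrite normrM ler_wpM2l// ger0_norm ?im_ker_le//.
    by rewrite ltW// im_ker_gt0.
- exact: (integrable_im_ker_mul (M := M)).
- move: (ae_neq b) (ae_neq L) kae.
  apply: filterS3; first exact: (ae_filter_ringOfSetsType leb).
  move=> u ub uL ku; rewrite /= in_itv/= => /andP[Lu uL'].
  have [|k0 kab] := ku; first by rewrite Lu lt_neqAle uL.
  rewrite patchE; case: ifPn => [|_].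
    rewrite inE/= in_itv/= => /andP[au ub'].
    rewrite mulrC ler_wpM2l ?(ltW (im_ker_gt0 _ y0))//.
    by apply: kab; rewrite au lt_neqAle ub.
  by rewrite mulr_ge0// ltW// im_ker_gt0.
Qed.


(** Up to boundary terms of the right sign the angle is the integral of [im_ker] against
    [(1 - w') / 2], which (i) confines to [[delta / 2, 1 - delta / 2]] on [[a, b]]. As [x0] is at
    distance at least [r] from both endpoints and [y <= 1], the kernel has mass at least
    [2 * atan r] there. *)
Lemma cauchy_angle_bounds (w h : R -> R) (L delta a b r x0 y : R) :
  continual_diagram w -> is_hump_density w L h -> 0 < L ->
  (forall s t : R, a <= s <= b -> a <= t <= b ->
     `|w s - w t| <= (1 - delta) * `|s - t|) ->
  - L <= a -> b <= L -> 0 < r -> a + r <= x0 <= b - r -> 0 < y <= 1 -> 0 <= delta ->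
  delta * atan r <= cauchy_angle L h x0 y <= pi - delta * atan r.
Proof.
move=> [_ [lip1 _]] [mh h1 dh _] L0 lipd La bL r0 /andP[ax xb] /andP[y0 y1] d0.
have ab : a <= b by lra.
(* The angle equals [pi / 2 - atan ((x0 + L) / y) + \int im_ker * k], where
   [0 <= k <= 1] in general and [delta / 2 <= k <= 1 - delta / 2] on [[a, b]]. *)
pose neg (u : R) : R := (u < 0)%R%:R.
pose k u := neg u - h u.
have mneg : measurable_fun setT neg.
  rewrite (_ : neg = \1_(`]-oo, 0[%classic : set R)); first exact: measurable_indic.
  apply/funext => u; rewrite indicE /neg; congr (_%:R); congr nat_of_bool.
  by apply/idP/idP => [u0|]; rewrite ?inE/= in_itv.
have mk : measurable_fun setT k by exact: measurable_funB.
have neg1 u : `|neg u| <= 1.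
  by rewrite /neg; case: (_ < _)%R; rewrite ?normr1// normr0.
have kM u : `|k u| <= 2 by rewrite (le_trans (ler_normB _ _))// (_ : 2 = 1 + 1)// lerD.
have k1M u : `|1 - k u| <= 3.
  by rewrite (le_trans (ler_normB _ _))// normr1 (_ : 3 = 1 + 2) ?lerD//; ring.
have kae : {ae leb, forall u : R, - L < u < L ->
    (0 <= k u <= 1) /\ (a < u < b -> delta / 2 <= k u <= 1 - delta / 2)}.
  move: (ae_neq 0) dh; apply: filterS2; first exact: (ae_filter_ringOfSetsType leb).
  move=> u u0 du uL; have dhu := du uL; split.
    have /andP[] : (1 - 1) / 2 <= neg u - h u <= (1 + 1) / 2.
      apply: (hump_derive_bounds (w := w) (u := u - 1) (v := u + 1)) => //.
        by move=> s t _ _; rewrite mul1r.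
      by apply/andP; split; lra.
    by rewrite /k => k0 k1; apply/andP; split; lra.
  move=> uab.
  have /andP[] : (1 - (1 - delta)) / 2 <= neg u - h u <= (1 + (1 - delta)) / 2.
    apply: (hump_derive_bounds (w := w) (u := a) (v := b)) => //.
    by move=> s t /andP[? ?] /andP[? ?]; apply: lipd; apply/andP; split; apply: ltW.
  by rewrite /k => k0 k1; apply/andP; split; lra.
(* The indicator of the negative half-line turns the slope of the hump into [(1 - w') / 2]; its own
   integral cancels the term [atan (x0 / y)] of the angle. *)
have Pneg : \int[leb]_(u in `](- L), L]) (im_ker y (x0 - u) * neg u) =
    atan ((x0 + L) / y) - atan (x0 / y).
  transitivity (\int[leb]_(u in `](- L), 0[) im_ker y (x0 - u)).
    have -> : `](- L), 0[%classic = `](- L), L]%classic `&` `]-oo, 0[%classic :> set R.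
      apply/seteqP; split => u /=; rewrite !in_itv/=.
        by move=> /andP[-> u0]; rewrite u0 (ltW (lt_trans u0 L0)).
      by move=> [/andP[-> _] ->].
    rewrite Rintegral_mkcondr; apply: eq_Rintegral => u _.
    rewrite patchE /neg; case: ifPn.
      by rewrite inE/= in_itv/= => ->; rewrite mulr1.
    by rewrite notin_setE/= in_itv/= => /negP/negbTE ->; rewrite mulr0.
  rewrite Rintegral_itv_bndo_bndc.
    by rewrite integral_im_ker ?oppr_le0 ?(ltW L0)// subr0 opprK.
  apply: integrableS (integrable_im_ker x0 (- L) 0 y0) => //.
  by apply: subset_itvl; rewrite bnd_simp.
have imE : im_log L h x0 y = atan ((x0 + L) / y) - atan (x0 / y) -
    \int[leb]_(u in `](- L), L]) (im_ker y (x0 - u) * k u).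
  rewrite -Pneg -RintegralB//; last 2 first.
  - exact: (integrable_im_ker_mul (M := 1)).
  - exact: (integrable_im_ker_mul (M := 2)).
  by apply: eq_Rintegral => u _; rewrite /k; ring.
have lo := @poisson_lower_bound k L 2 x0 y a b (delta / 2) y0 mk kM La ab bL.
have m1k : measurable_fun setT (fun u => 1 - k u) by exact: measurable_funB.
(* The upper bound on the angle is the lower bound for [1 - k]. *)
have hi := @poisson_lower_bound (fun u => 1 - k u) L 3 x0 y a b (delta / 2)
  y0 m1k k1M La ab bL.
have {}lo := lo ltac:(move: kae; apply: filterS;
  [exact: (ae_filter_ringOfSetsType leb)|
   by move=> u H /H[/andP[? ?] H2]; split => // /H2/andP[]]).
have {}hi := hi ltac:(move: kae; apply: filterS;
  [exact: (ae_filter_ringOfSetsType leb)|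
   by move=> u H /H[/andP[? ?] H2]; split => [|/H2/andP[? ?]]; lra]).
have hiE : \int[leb]_(u in `](- L), L]) (im_ker y (x0 - u) * (1 - k u)) =
    atan ((x0 + L) / y) - atan ((x0 - L) / y) -
    \int[leb]_(u in `](- L), L]) (im_ker y (x0 - u) * k u).
  have <- : \int[leb]_(u in `](- L), L]) im_ker y (x0 - u) =
      atan ((x0 + L) / y) - atan ((x0 - L) / y).
    by rewrite integral_im_ker ?opprK// ge0_cp// ltW.
  rewrite -RintegralB//; last 2 first.
  - exact: integrable_im_ker.
  - exact: (integrable_im_ker_mul (M := 2)).
  by apply: eq_Rintegral => u _; ring.
rewrite hiE in hi.
have ya (s : R) : r <= s -> atan r <= atan (s / y).
  by move=> rs; apply: le_atan; rewrite ler_pdivlMr// (le_trans _ rs)// ler_piMr// ltW.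
have at1 := ya (x0 - a) ltac:(lra).
have at2 := ya (b - x0) ltac:(lra).
have at3 : atan ((x0 - b) / y) = - atan ((b - x0) / y).
  by rewrite -atanN -mulNr opprB.
have := atan_ltpi2 ((x0 + L) / y); have := atan_gtNpi2 ((x0 - L) / y).
rewrite /cauchy_angle imE; rewrite at3 opprK in lo hi.
set I := \int[leb]_(u in _) _ in lo hi *.
have aa : 2 * atan r <= atan ((x0 - a) / y) + atan ((b - x0) / y) by lra.
have : delta * atan r <= delta / 2 * (atan ((x0 - a) / y) + atan ((b - x0) / y)).
  by rewrite -mulrA ler_wpM2l// ler_pdivlMl.
set dA := delta * atan r; set dB := delta / 2 * _ in lo hi *.
move=> h2 h3 h4.
apply/andP; split; lra.
Qed.

End Polar.

(** * Stability of the logarithm of the Cauchy transform *)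

Section LogClose.
Context {R : realType}.
Local Notation leb := (@lebesgue_measure R).

(** By parts, the difference is minus the integral of [phi'] against the difference of the humps,
    which is at most [eps], while [phi'] is at most [im_ker / y] and [im_ker] has total mass at most
    [pi]. Leaving [phi] abstract serves both the real and the imaginary kernel. *)
Lemma kernel_log_close (w1 w2 h1 h2 phi phi' : R -> R) (L eps x0 y : R) :
  continual_diagram w1 -> continual_diagram w2 ->
  is_hump_density w1 L h1 -> is_hump_density w2 L h2 -> 0 < L ->
  (forall z, L <= `|z| -> w1 z = `|z|) -> (forall z, L <= `|z| -> w2 z = `|z|) ->
  (forall v, `|w2 v - w1 v| <= 2 * eps) -> 0 < y ->
  (forall u : R, is_derive u 1 phi (phi' u)) -> measurable_fun setT phi' ->
  (forall u, `|phi u| <= y^-1) ->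
  (forall u, `|phi' u| <= im_ker y (x0 - u) / y) ->
  `|\int[leb]_(u in `](- L), L]) (phi u * h2 u) -
    \int[leb]_(u in `](- L), L]) (phi u * h1 u)| <= eps * pi / y.
Proof.
move=> c1 c2 [mh1 h1b dh1 _] [mh2 h2b dh2 _] L0 wL1 wL2 close y0 dphi mphi' phib phi'b.
have LL : - L < L by lra.
have phi'B u : `|phi' u| <= y ^- 2.
  by rewrite (le_trans (phi'b u))// im_ker_div_le.
have y2 : 0 <= y ^- 2 by rewrite invr_ge0 sqr_ge0.
have lipphi := is_derive_le_lipschitz dphi phi'B.
have mphi : measurable_fun setT phi.
  by apply: continuous_measurable_fun; exact: continuous_lipschitz lipphi.
pose D v := hump w2 v - hump w1 v.
have DE v : D v = (w2 v - w1 v) / 2 by rewrite /D /hump; field.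
have Db v : `|D v| <= eps.
  by rewrite DE normrM (gtr0_norm (_ : 0 < 2^-1)) ?invr_gt0// ler_pdivrMr// mulrC.
have lipD v1 v2 : `|D v1 - D v2| <= 2 * `|v1 - v2|.
  have -> : D v1 - D v2 = (hump w2 v1 - hump w2 v2) - (hump w1 v1 - hump w1 v2).
    by rewrite /D; ring.
  rewrite (le_trans (ler_normB _ _))// mulr_natl mulr2n lerD//.
    by have := hump_lipschitz v1 v2 c2; rewrite mul1r.
  by have := hump_lipschitz v1 v2 c1; rewrite mul1r.
have DL : D (- L) = 0.
  by rewrite DE wL1 ?wL2 ?normrN ?ger0_norm ?subrr ?mul0r// ltW.
have DL' : D L = 0.
  by rewrite DE wL1 ?wL2 ?ger0_norm ?subrr ?mul0r// ltW.
pose h u := h2 u - h1 u.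
have mh : measurable_fun setT h by exact: measurable_funB.
have hb u : `|h u| <= 2.
  by rewrite (le_trans (ler_normB _ _))// (_ : 2 = 1 + 1)// lerD.
have dh : {ae leb, forall x : R, - L < x < L -> is_derive x 1 D (h x)}.
  move: dh1 dh2; apply: filterS2; first exact: (ae_filter_ringOfSetsType leb).
  by move=> x d1 d2 /[dup] /d1 {}d1 /d2 {}d2; exact: is_deriveB.
have iphi (k : R -> R) : measurable_fun setT k -> (forall u, `|k u| <= 1) ->
    leb.-integrable `](- L), L] (EFin \o (fun u => phi u * k u)).
  move=> mk kb; apply: (@bounded_integrable _ _ _ _ _ _ (y^-1 * 1)) => //.
  - exact: lebesgue_itv_lty.
  - by apply: measurable_funTS; exact: measurable_funM.
  - by move=> u _; rewrite normrM ler_pM.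
rewrite -RintegralB//; [|exact: iphi..].
under eq_Rintegral do rewrite -mulrBr.
rewrite (lipschitz_by_parts LL _ y2 dphi phib phi'B mphi' lipphi lipD Db DL DL' mh hb dh)//.
rewrite normrN.
have mD : measurable_fun setT D.
  by apply: continuous_measurable_fun; exact: continuous_lipschitz lipD.
have eps0 : 0 <= eps by exact: le_trans (Db 0).
have i2 : leb.-integrable `](- L), L] (EFin \o (fun u => phi' u * D u)).
  apply: (@bounded_integrable _ _ _ _ _ _ (y ^- 2 * eps)) => //.
  - exact: lebesgue_itv_lty.
  - by apply: measurable_funTS; exact: measurable_funM.
  - by move=> u _; rewrite normrM ler_pM.
apply: (le_trans (le_normr_Rintegral _ i2)) => //.
apply: (@le_trans _ _ (\int[leb]_(u in `](- L), L]) (eps / y * im_ker y (x0 - u)))).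
  apply: le_Rintegral => //.
  - exact: integrable_norm.
  - by apply: integrableZl_EFin => //; exact: integrable_im_ker.
  - move=> u _; rewrite normrM.
    by rewrite (_ : eps / y * _ = im_ker y (x0 - u) / y * eps) ?ler_pM//; ring.
rewrite RintegralZl//; last exact: integrable_im_ker.
rewrite integral_im_ker//; last exact: ltW.
rewrite (mulrAC eps pi) ler_wpM2l//; first by rewrite divr_ge0// ltW.
have := atan_ltpi2 ((x0 - - L) / y); have := atan_gtNpi2 ((x0 - L) / y).
by lra.
Qed.

(** Writes the derivative in terms of kernels already known to be measurable. *)
Lemma re_ker'E (y s : R) : 0 < y -> re_ker' y s = im_ker y s ^+ 2 - re_ker y s ^+ 2.
Proof.
move=> y0; rewrite /re_ker' /im_ker /re_ker; field.
by rewrite gt_eqF// ker_denom_gt0.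
Qed.

Lemma im_ker'E (y s : R) : 0 < y -> im_ker' y s = - 2 * re_ker y s * im_ker y s.
Proof.
move=> y0; rewrite /im_ker' /im_ker /re_ker; field.
by rewrite gt_eqF// ker_denom_gt0.
Qed.

Lemma log_close (w1 w2 h1 h2 : R -> R) (L eps x0 y : R) :
  continual_diagram w1 -> continual_diagram w2 ->
  is_hump_density w1 L h1 -> is_hump_density w2 L h2 -> 0 < L ->
  (forall z, L <= `|z| -> w1 z = `|z|) -> (forall z, L <= `|z| -> w2 z = `|z|) ->
  (forall v, `|w2 v - w1 v| <= 2 * eps) -> 0 < y ->
  `|re_log L h2 x0 y - re_log L h1 x0 y| <= eps * pi / y /\
  `|im_log L h2 x0 y - im_log L h1 x0 y| <= eps * pi / y.
Proof.
move=> c1 c2 d1 d2 L0 wL1 wL2 close y0.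
have dsub (u : R) : is_derive u 1 (fun u : R => x0 - u) (-1).
  by apply: is_derive_eq; rewrite /GRing.scale/=; ring.
split.
- apply: (kernel_log_close (phi' := fun u => - re_ker' y (x0 - u)) c1 c2 d1 d2) => //.
  + move=> u; have := is_derive1_comp (g := fun u : R => x0 - u)
      (is_derive_re_ker (x0 - u) y0) (dsub u).
    by rewrite mulrN1.
  + apply: measurableT_comp => //.
    have -> : (fun u => re_ker' y (x0 - u)) =
        (fun u => im_ker y (x0 - u) ^+ 2 - re_ker y (x0 - u) ^+ 2).
      by apply/funext => u; exact: re_ker'E.
    by apply: measurable_funB; apply: measurable_funX;
      [exact: measurable_im_ker|exact: measurable_re_ker].
  + by move=> u; exact: norm_re_ker_le.
  + by move=> u; rewrite normrN; exact: norm_re_ker'_le.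
- apply: (kernel_log_close (phi' := fun u => - im_ker' y (x0 - u)) c1 c2 d1 d2) => //.
  + move=> u; have := is_derive1_comp (g := fun u : R => x0 - u)
      (is_derive_im_ker (x0 - u) y0) (dsub u).
    by rewrite mulrN1.
  + apply: measurableT_comp => //.
    have -> : (fun u => im_ker' y (x0 - u)) =
        (fun u => - 2 * re_ker y (x0 - u) * im_ker y (x0 - u)).
      by apply/funext => u; exact: im_ker'E.
    apply: measurable_funM; last exact: measurable_im_ker.
    by apply: measurable_funM => //; exact: measurable_re_ker.
  + by move=> u; rewrite ger0_norm ?im_ker_le// ltW// im_ker_gt0.
  + by move=> u; rewrite normrN; exact: norm_im_ker'_le.
Qed.

End LogClose.

(** * Integration against a measure with bounded density *)

Section DensityIntegral.
Context {R : realType}.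
Local Notation leb := (@lebesgue_measure R).

Let id_mR (x : measurableTypeR R) : R := x.

Let measurable_id_mR : measurable_fun setT id_mR.
Proof. by move=> _ A mA; rewrite setTI. Qed.

(* [leb] lives on [measurableTypeR R], whose display differs from that of [R]. *)
Let leb' := pushforward leb id_mR.

Lemma density_integral_le (mu : probability R R) (a b M : R) (f g : R -> R) :
  measurable_fun [set x : R | a <= x <= b] f ->
  (forall x, a <= x <= b -> 0 <= f x <= M) ->
  (forall A : set R, measurable A -> A `<=` [set x : R | a <= x <= b] ->
     (mu A = \int[leb]_(x in A) (f x)%:E)%E) ->
  0 <= M -> measurable_fun setT g -> (forall x, 0 <= g x) ->
  (\int[mu]_x ((g \_ `[a, b]) x)%:E <= M%:E * \int[leb]_(x in `[a, b]) (g x)%:E)%E.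
Proof.
move=> mf fM muE M0 mg g0.
have abE : [set x : R | a <= x <= b] = `[a, b]%classic.
  by apply/seteqP; split => x /=; rewrite in_itv.
rewrite abE in mf muE.
have mab : measurable (`[a, b]%classic : set R) by exact: measurable_itv.
have mabC : measurable (~` `[a, b]%classic : set R) by exact: measurableC.
pose lebm_ : {measure set R -> \bar R} := leb'.
pose lebm := lebm_ measurable_id_mR.
(* [mu] is dominated by [M] times Lebesgue measure plus its own restriction to the complement of
   [[a, b]]; the latter does not see a function supported in [[a, b]]. *)
pose m2 := measure_add (mscale (NngNum M0) lebm) (mrestr mu mabC).
have mum2 S : measurable S -> (mu S <= m2 S)%E.
  move=> mS; rewrite /m2 [leRHS]measure_addE.
  rewrite -{1}(setIT S) -(setUv `[a, b]%classic) setIUr measureU//; last 3 first.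
  - exact: measurableI.
  - exact: measurableI.
  - by rewrite setIACA setICr setI0.
  apply: leeD => //.
  have E := muE (S `&` `[a, b]) (measurableI _ _ mS mab) (@subIsetr _ _ _).
  rewrite [leLHS]E.
  apply: (@le_trans _ _ (\int[leb]_(x in S `&` `[a, b]) M%:E)%E).
    apply: ge0_le_integral => //.
    + exact: measurableI.
    + by move=> x [_] /=; rewrite in_itv/= lee_fin => /fM/andP[].
    + by apply/measurable_EFinP; apply: measurable_funS mf.
    + by move=> x [_] /=; rewrite in_itv/= lee_fin => /fM/andP[].
  rewrite integral_cst; last exact: measurableI.
  rewrite /mscale/= /pushforward/=.
  by apply: lee_wpmul2l; rewrite ?lee_fin// le_measure ?inE//; exact: measurableI.
have gp0 x : 0 <= (g \_ `[a, b]) x by rewrite patchE; case: ifP.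
have mgp : measurable_fun setT (EFin \o (g \_ `[a, b])).
  apply/measurable_EFinP/(measurable_restrictT _ _).1 => //.
  exact: measurable_funTS.
apply: (@le_trans _ _ (\int[m2]_x ((g \_ `[a, b]) x)%:E)%E).
  by apply: ge0_le_measure_integral => // x; rewrite lee_fin.
rewrite ge0_integral_measure_add//; last by move=> x _; rewrite lee_fin.
rewrite ge0_integral_mscale//; last by move=> x _; rewrite lee_fin.
rewrite [X in (_ + X)%E](_ : _ = 0%E); last first.
  rewrite -[RHS](@integral0 _ _ _ (mrestr mu mabC) setT).
  apply: ge0_ae_eq_integral => //; first by move=> x _; rewrite lee_fin.
  exists `[a, b]%classic; split => //.
    have : mu (`[a, b]%classic `&` ~` `[a, b]%classic) = 0%E.
      by rewrite setICr measure0.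
    exact.
  move=> x /= nx; apply: contrapT => xab; apply: nx => _.
  by rewrite patchE memNset.
rewrite adde0 lee_wpmul2l ?lee_fin//.
rewrite ge0_integral_pushforward//; last by move=> x _; rewrite lee_fin.
rewrite [leRHS]integral_mkcond.
by rewrite restrict_EFin.
Qed.

End DensityIntegral.

(** * Comparison of two Cauchy transforms *)

Section Perturbation.
Context {R : realType}.

(** From above, [expR t <= 1 / (1 - t) <= 1 + 2 * t] for [0 <= t <= 1 / 2]; from below,
    [1 + p <= expR p]. *)
Lemma expR_near1 (p t : R) : `|p| <= t -> t <= 1 / 2 -> `|expR p - 1| <= 2 * t.
Proof.
rewrite ler_norml => /andP[p1 p2] t1.
have e1 : expR p <= 1 + 2 * t.
  apply: (@le_trans _ _ (expR t)); first by rewrite ler_expR.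
  have := expR_ge1Dx (- t); rewrite expRN => h.
  have t0 : 0 < 1 - t by lra.
  have : expR t <= (1 - t)^-1.
    by rewrite -[leLHS]invrK lef_pV2 ?posrE ?invr_gt0 ?expR_gt0.
  move=> /le_trans; apply; rewrite -div1r ler_pdivrMr//.
  have : 0 <= t * (1 - 2 * t) by apply: mulr_ge0; lra.
  by lra.
have e2 := expR_ge1Dx p.
by rewrite ler_norml; apply/andP; split; lra.
Qed.

Lemma cos_lipschitz (x y : R) : `|cos x - cos y| <= `|x - y|.
Proof.
rewrite -[leRHS]mul1r.
apply: (is_derive_le_lipschitz (f' := fun x => - sin x)) => z.
by rewrite normrN; exact: sin_max.
Qed.

(** The constant [3] is [2] for the change of modulus plus [1] for the change of angle, cosine being
    1-Lipschitz. *)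
Lemma polar_perturbation (r psi p q t : R) : 0 <= r -> `|p| <= t -> `|q| <= t ->
  t <= 1 / 2 -> `|r * expR p * cos (psi - q) - r * cos psi| <= 3 * r * t /\
    r * expR p <= 2 * r.
Proof.
move=> r0 pt qt t1; have ep := expR_near1 pt t1.
split.
  have -> : r * expR p * cos (psi - q) - r * cos psi =
      r * ((expR p - 1) * cos (psi - q) + (cos (psi - q) - cos psi)) by ring.
  rewrite normrM ger0_norm// (mulrC 3) -mulrA ler_wpM2l//.
  rewrite (le_trans (ler_normD _ _))// normrM.
  have c1 := cos_max (psi - q).
  have c2 := cos_lipschitz (psi - q) psi.
  have : psi - q - psi = - q by ring.
  move: c2 => /[swap] -> ; rewrite normrN => c2.
  have : `|expR p - 1| * `|cos (psi - q)| <= 2 * t * 1 by exact: ler_pM.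
  by lra.
rewrite (mulrC 2) ler_wpM2l//.
by move: ep; rewrite ler_norml => /andP[_]; lra.
Qed.

Lemma sin_ge (c psi : R) : 0 <= c -> c <= psi -> psi <= pi - c -> sin c <= sin psi.
Proof.
have pi0 := pi_gt0 R.
move=> c0 cpsi psic; have cpi : c <= pi / 2 by lra.
wlog ph : psi cpsi psic / psi <= pi / 2.
  move=> H; have [/H|ph] := leP psi (pi / 2); first exact.
  have -> : sin psi = sin (pi - psi).
    by rewrite sinB sinpi cospi mul0r mulN1r sub0r opprK.
  by apply: H; lra.
by rewrite leNgt ltr_sin -?leNgt// in_itv/=; apply/andP; split; lra.
Qed.

End Perturbation.

Section ImBound.
Context {R : realType}.
Local Notation leb := (@lebesgue_measure R).

(** Inside [[a, b]] the density is at most [M] and the kernel has mass at most [pi]; outside,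
    [|x0 - x| >= r] and [y <= 1] bound the kernel by [r ^- 2]. *)
Lemma stieltjes_im_bound (mu : probability R R) (a b M r x0 y : R) (f : R -> R) :
  measurable_fun [set x : R | a <= x <= b] f ->
  (forall x, a <= x <= b -> 0 <= f x <= M) ->
  (forall A : set R, measurable A -> A `<=` [set x : R | a <= x <= b] ->
     (mu A = \int[leb]_(x in A) (f x)%:E)%E) ->
  0 < r -> a + r <= x0 <= b - r -> 0 < y <= 1 ->
  \int[mu]_x im_ker y (x0 - x) <= M * pi + r ^- 2.
Proof.
move=> mf fM muE r0 /andP[ax xb] /andP[y0 y1].
have ab : a <= b by lra.
have M0 : 0 <= M by have /andP[] := fM a ltac:(lra); exact: le_trans.
have muT : (mu setT < +oo)%E by rewrite probability_setT ltry.
pose g x := im_ker y (x0 - x).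
have g0 x : 0 <= g x by rewrite ltW// im_ker_gt0.
have mg : measurable_fun setT g by exact: measurable_im_ker.
have key := density_integral_le mf fM muE M0 mg g0.
have mgp : measurable_fun setT (g \_ `[a, b]).
  by apply/(measurable_restrictT _ _).1 => //; exact: measurable_funTS.
have ig : mu.-integrable setT (EFin \o g).
  apply: (@bounded_integrable _ _ _ _ _ _ y^-1) => //.
  by move=> x _; rewrite ger0_norm// im_ker_le.
have igp : mu.-integrable setT (EFin \o (g \_ `[a, b])).
  apply: (@bounded_integrable _ _ _ _ _ _ y^-1) => //.
  move=> x _; rewrite patchE; case: ifP => _; first by rewrite ger0_norm// im_ker_le.
  by rewrite normr0 invr_ge0 ltW.
have ic (c : R) : mu.-integrable setT (EFin \o cst c).
  exact: (@bounded_integrable _ _ _ _ _ _ `|c|).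
apply: (@le_trans _ _ (\int[mu]_x ((g \_ `[a, b]) x + cst (r ^- 2) x))).
  apply: le_Rintegral => //; first exact: integrableD_EFin.
  move=> x _; rewrite patchE; case: ifPn => [_|].
    by rewrite lerDl invr_ge0 sqr_ge0.
  rewrite notin_setE/= in_itv/= => /negP; rewrite negb_and -!ltNge => xab.
  rewrite add0r /g /im_ker.
  have rs : r ^+ 2 <= (x0 - x) ^+ 2.
    rewrite -(real_normK (num_real (x0 - x))).
    rewrite ler_pXn2r ?nnegrE ?(ltW r0)// ler_normr.
    by case/orP: xab => xab; apply/orP; [left|right]; lra.
  have r20 : 0 < r ^+ 2 by rewrite exprn_gt0.
  rewrite ler_pdivrMr ?ker_denom_gt0// mulrC ler_pdivlMr//.
  have : y * r ^+ 2 <= 1 * r ^+ 2 by rewrite ler_wpM2r// ltW.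
  by have := sqr_ge0 y; lra.
rewrite RintegralD// Rintegral_cst//.
rewrite [X in _ * fine X](_ : _ = 1%E); last exact: probability_setT.
rewrite /= mulr1 lerD2r.
have pE : (\int[leb]_(x in `[a, b]) (g x)%:E)%E = (\int[leb]_(x in `]a, b]) g x)%:E.
  rewrite /Rintegral fineK.
    rewrite integral_itv_obnd_cbnd//; exact/measurable_EFinP/measurable_funTS.
  by apply: integrable_fin_num => //; exact: integrable_im_ker.
rewrite pE -EFinM in key.
rewrite -lee_fin /Rintegral fineK; last exact: integrable_fin_num.
apply: (le_trans key); rewrite lee_fin ler_wpM2l// integral_im_ker//.
have := atan_ltpi2 ((x0 - a) / y); have := atan_gtNpi2 ((x0 - b) / y).
by lra.
Qed.

End ImBound.

Section Comparison.
Context {R : realType}.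
Local Notation leb := (@lebesgue_measure R).
Implicit Types mu : probability R R.

Lemma prob_lty mu : (mu setT < +oo)%E.
Proof. by rewrite probability_setT ltry. Qed.

Lemma bounded_prob_integrable mu (g : R -> R) (c : R) : measurable_fun setT g ->
  (forall x, `|g x| <= c) -> mu.-integrable setT (EFin \o g).
Proof.
move=> mg gc; apply: (@bounded_integrable _ _ _ _ _ _ c) => //.
exact: prob_lty.
Qed.

Lemma Rintegral_prob_cst mu (c : R) : \int[mu]_x cst c x = c.
Proof.
rewrite Rintegral_cst// [X in _ * fine X](_ : _ = 1%E) ?mulr1//.
exact: probability_setT.
Qed.

Lemma norm_Rintegral_prob_le mu (g : R -> R) (c : R) : measurable_fun setT g ->
  (forall x, `|g x| <= c) -> `|\int[mu]_x g x| <= c.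
Proof.
move=> mg gc; have ig := bounded_prob_integrable mu mg gc.
apply: (le_trans (le_normr_Rintegral _ ig)) => //.
rewrite -[leRHS](Rintegral_prob_cst mu); apply: le_Rintegral => //.
- exact: integrable_norm.
- exact: (@bounded_prob_integrable _ _ `|c|).
Qed.

Lemma cauchy_mod_gt0 L h (x0 y : R) : 0 < y -> 0 < cauchy_mod L h x0 y.
Proof.
by move=> y0; rewrite divr_gt0 ?expR_gt0// sqrtr_gt0 ker_denom_gt0.
Qed.

Lemma polar_modulus_le (m psi B : R) :
  `|m * cos psi| <= B -> `|m * sin psi| <= B -> m <= B * 2.
Proof.
move=> h1 h2.
have -> : m = (m * cos psi) * cos psi + (m * sin psi) * sin psi.
  by rewrite -!mulrA -!expr2 -mulrDr cos2Dsin2 mulr1.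
rewrite (le_trans (ler_norm _))// (le_trans (ler_normD _ _))// !(normrM (_ * _)).
have : `|m * cos psi| * `|cos psi| <= B * 1 by rewrite ler_pM// cos_max.
have : `|m * sin psi| * `|sin psi| <= B * 1 by rewrite ler_pM// sin_max.
by lra.
Qed.

(** Both kernels are at most [1 / y]. This crude bound is available at every height, in particular
    above [1], where it gives the decay in [y]. *)
Lemma cauchy_mod_le (w : R -> R) mu L h (x0 y : R) : transition_measure w mu ->
  is_hump_density w L h -> 0 < y -> cauchy_mod L h x0 y <= y^-1 * 2.
Proof.
move=> tw hw y0; have [reE imE] := transition_polar x0 tw hw y0.
have m0 := cauchy_mod_gt0 L h x0 y0.
set m := cauchy_mod L h x0 y in reE imE m0 *.
set psi := cauchy_angle L h x0 y in reE imE *.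
have re1 : `|m * cos psi| <= y^-1.
  rewrite -reE; apply: norm_Rintegral_prob_le; first exact: measurable_re_ker.
  by move=> x; exact: norm_re_ker_le.
have im1 : `|m * sin psi| <= y^-1.
  rewrite -imE; apply: norm_Rintegral_prob_le; first exact: measurable_im_ker.
  by move=> x; rewrite ger0_norm ?im_ker_le// ltW// im_ker_gt0.
exact: (polar_modulus_le re1 im1).
Qed.

(** For [y <= 1] the modulus of the transform of [Omega] is its imaginary part, bounded by (ii),
    divided by the sine of its angle, bounded below by (i); at every height it is at most [2 / y].
    Multiplying by the relative error, of order [eps / y], gives the two estimates on real parts.
    The constant depends on neither [w] nor [eps]. *)
Lemma cauchy_comparison (Omega : R -> R) muOmega (a a0 b0 b delta : R)
    (f : R -> R) (M : R) :
  continual_diagram Omega -> transition_measure Omega muOmega ->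
  a < a0 -> a0 < b0 -> b0 < b -> 0 < delta ->
  (forall x y, a <= x <= b -> a <= y <= b ->
       `|Omega x - Omega y| <= (1 - delta) * `|x - y|) ->
  measurable_fun [set x : R | a <= x <= b] f ->
  (forall x, a <= x <= b -> 0 <= f x <= M) ->
  (forall A : set R, measurable A -> A `<=` [set x : R | a <= x <= b] ->
     (muOmega A = \int[leb]_(x in A) (f x)%:E)%E) ->
  exists2 C : R, 0 < C & forall (w : R -> R) mu (eps x0 y : R),
    continual_diagram w -> transition_measure w mu ->
    0 < eps -> (forall v, `|w v - Omega v| <= 2 * eps) ->
    a0 <= x0 <= b0 -> 2 * pi * eps <= y ->
    [/\ y <= 1 -> \int[muOmega]_x im_ker y (x0 - x) <= C,
        y <= 1 -> \int[mu]_x im_ker y (x0 - x) <= C,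
        y <= 1 -> `|\int[mu]_x re_ker y (x0 - x) - \int[muOmega]_x re_ker y (x0 - x)|
                    <= C * eps / y &
        `|\int[mu]_x re_ker y (x0 - x) - \int[muOmega]_x re_ker y (x0 - x)|
                    <= C * eps / y ^+ 2].
Proof.
move=> cO tO aa0 ab0 bb0 d0 lipO mf fM muE.
pose r : R := Num.min (a0 - a) (b - b0).
have r0 : 0 < r by rewrite lt_min !subr_gt0 aa0.
have ra : a + r <= a0 by rewrite -lerBrDl ge_min lexx.
have rb : b0 <= b - r by rewrite lerBrDl -lerBrDr ge_min lexx orbT.
pose c := delta * atan r.
have c0 : 0 < c by rewrite mulr_gt0// -(@atan0 R) lt_atan.
have pi0 := pi_gt0 R.
have M0 : 0 <= M by have /andP[] := fM a ltac:(lra); exact: le_trans.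
pose C1 := M * pi + r ^- 2.
have C10 : 0 < C1 by rewrite ltr_wpDl ?mulr_ge0 ?(ltW pi0)// invr_gt0 exprn_gt0.
(* The absolute value makes [s] nonnegative at once; [sin c > 0] follows later from
   [c <= psi <= pi - c]. *)
pose s : R := `|sin c|^-1.
pose C2 := C1 * s.
have C20 : 0 <= C2 by rewrite mulr_ge0 ?(ltW C10)// invr_ge0.
(* A sum dominating the four bounds obtained below: [C2], [2 * C2], [3 * C2 * pi] and [6 * pi]. *)
exists (C1 + 2 * C2 + 3 * C2 * pi + 6 * pi).
  by have := mulr_ge0 C20 (ltW pi0); lra.
move=> w mu eps x0 y cw tw eps0 wO /andP[x0a x0b] epsy.
have y0 : 0 < y by apply: lt_le_trans epsy; rewrite !mulr_gt0.
have [_ [_ [M1 MO]]] := cO.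
have [_ [_ [M2 Mw]]] := cw.
(* One window outside which both diagrams equal the absolute value, and which contains [[a, b]]. It
   depends on [w] but enters none of the constants. *)
pose L : R := `|M1| + `|M2| + `|a| + `|b| + 1.
have [n1 n2 n3 n4] : [/\ 0 <= `|M1|, 0 <= `|M2|, 0 <= `|a| & 0 <= `|b|] by [].
have LM1 : M1 <= L by have := ler_norm M1; rewrite /L; lra.
have LM2 : M2 <= L by have := ler_norm M2; rewrite /L; lra.
have La : - L <= a by have := ler_norm (- a); rewrite normrN /L; lra.
have Lb : b <= L by have := ler_norm b; rewrite /L; lra.
have L0 : 0 < L by rewrite /L; lra.
have OL z : L <= `|z| -> Omega z = `|z| by move=> Lz; apply: MO; exact: le_trans Lz.
have wL z : L <= `|z| -> w z = `|z| by move=> Lz; apply: Mw; exact: le_trans Lz.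
have [h1 dh1] := hump_density cO L0 OL.
have [h2 dh2] := hump_density cw L0 wL.
have [reO imO] := transition_polar x0 tO dh1 y0.
have [rew imw] := transition_polar x0 tw dh2 y0.
have m0 := cauchy_mod_gt0 L h1 x0 y0.
have m2y := cauchy_mod_le x0 tO dh1 y0.
have [rcl icl] := log_close x0 cO cw dh1 dh2 L0 OL wL wO y0.
set m := cauchy_mod L h1 x0 y in reO imO m0 m2y.
set psi := cauchy_angle L h1 x0 y in reO imO.
pose p := - (re_log L h2 x0 y - re_log L h1 x0 y).
pose q := im_log L h2 x0 y - im_log L h1 x0 y.
have mE : cauchy_mod L h2 x0 y = m * expR p.
  rewrite /m /cauchy_mod mulrAC -expRD; congr (expR _ / _); rewrite /p; ring.
have psiE : cauchy_angle L h2 x0 y = psi - q.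
  rewrite /psi /q /cauchy_angle; ring.
rewrite mE psiE in rew imw.
have x0ab : a + r <= x0 <= b - r by apply/andP; split; lra.
have angle : y <= 1 -> c <= psi <= pi - c.
  move=> y1; have y01 : 0 < y <= 1 by rewrite y0.
  exact: cauchy_angle_bounds cO dh1 L0 lipO La Lb r0 x0ab y01 (ltW d0).
clear mE psiE; clearbody m psi.
(* The bound of [log_close]; the condition [2 * pi * eps <= y] is exactly [t <= 1 / 2]. *)
pose t := eps * pi / y.
have pt : `|p| <= t by rewrite normrN.
have t2 : t <= 1 / 2 by rewrite /t ler_pdivrMr//; lra.
have [pert1 pert2] := polar_perturbation psi (ltW m0) pt icl t2.
rewrite -rew -reO in pert1.
have my1 : y <= 1 -> m <= C2.
  move=> y1.
  have y01 : 0 < y <= 1 by rewrite y0.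
  have imb := stieltjes_im_bound mf fM muE r0 x0ab y01.
  have /andP[psi1 psi2] := angle y1.
  have sc : sin c <= sin psi by apply: sin_ge => //; exact: ltW.
  have sc0 : 0 < sin c.
    apply: sin_gt0_pi; rewrite c0/=.
    by lra.
  rewrite /C2 /s gtr0_norm// ler_pdivlMr//.
  by rewrite (le_trans _ imb)// imO ler_wpM2l// ltW.
have imb (y1 : y <= 1) : \int[muOmega]_x im_ker y (x0 - x) <= C2.
  rewrite imO (le_trans _ (my1 y1))// ler_piMr ?(ltW m0)//.
have t0 : 0 <= t by rewrite divr_ge0 ?mulr_ge0 ?ltW.
have C2pi : 0 <= C2 * pi by rewrite mulr_ge0 ?(ltW pi0).
split.
- move=> y1; have := imb y1; lra.
- move=> y1; rewrite imw.
  have := my1 y1.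
  have : m * expR p * sin (psi - q) <= m * expR p.
    by rewrite ler_piMr ?mulr_ge0 ?expR_ge0 ?(ltW m0)// sin_le1.
  by lra.
- move=> y1; apply: (le_trans pert1).
  have h1' : 3 * m * t <= 3 * C2 * t by rewrite ler_wpM2r// ler_wpM2l// my1.
  apply: (le_trans h1').
  have -> : 3 * C2 * t = 3 * C2 * pi * eps / y by rewrite /t; ring.
  by rewrite ler_wpM2r ?invr_ge0 ?(ltW y0)// ler_wpM2r ?(ltW eps0)//; lra.
- apply: (le_trans pert1).
  have h1' : 3 * m * t <= 3 * (y^-1 * 2) * t by rewrite ler_wpM2r// ler_wpM2l.
  apply: (le_trans h1').
  have -> : 3 * (y^-1 * 2) * t = 6 * pi * eps / y ^+ 2 by rewrite /t; field; rewrite gt_eqF.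
  rewrite ler_wpM2r ?invr_ge0 ?sqr_ge0// ler_wpM2r ?(ltW eps0)//; lra.
Qed.

End Comparison.

(** * From the Cauchy transform to the cumulative function *)

Section AtanTransform.
Context {R : realType}.
Implicit Types mu : probability R R.

Definition atan_transform mu (x0 y : R) := \int[mu]_x atan ((x0 - x) / y).

Lemma atan_norm_le2 (s : R) : `|atan s| <= pi / 2.
Proof. by rewrite ler_norml !ltW ?atan_gtNpi2 ?atan_ltpi2. Qed.

Lemma continuous_atan_div (x0 y : R) : continuous (fun x : R => atan ((x0 - x) / y)).
Proof.
move=> x; apply: (@continuous_comp _ _ _ (fun x => (x0 - x) / y) atan).
  by apply: cvgM; [apply: cvgB; [exact: cvg_cst|exact: cvg_id]|exact: cvg_cst].
exact: continuous_atan.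
Qed.

Lemma measurable_atan_div (x0 y : R) :
  measurable_fun setT (fun x : R => atan ((x0 - x) / y)).
Proof. apply: continuous_measurable_fun; exact: continuous_atan_div. Qed.

Lemma is_derive_atan_div (s y : R) : 0 < y ->
  is_derive y 1 (fun y => atan (s / y)) (- re_ker y s).
Proof.
move=> y0; have yn : y != 0 by rewrite gt_eqF.
have d0 := is_deriveV (f := fun y : R => y) yn (is_derive_id y 1).
have d1 : is_derive y 1 (fun y : R => s / y) (- (s / y ^+ 2)).
  apply: is_derive_eq; rewrite /GRing.scale/=; field; exact: yn.
have d2 := is_derive1_comp (g := fun y : R => s / y) (is_derive1_atan (s / y)) d1.
suff <- : (1 + (s / y) ^+ 2)^-1 * - (s / y ^+ 2) = - re_ker y s by [].
rewrite /re_ker; field; rewrite yn/=.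
have := ker_denom_gt0 s y0.
by rewrite addrC => /gt_eqF ->.
Qed.

Lemma is_derive_atan_transform mu (x0 y : R) : 0 < y ->
  is_derive y 1 (atan_transform mu x0) (- \int[mu]_x re_ker y (x0 - x)).
Proof.
move=> y0.
pose F (t x : R) := atan ((x0 - x) / t).
have d1 (t x : R) : 0 < t -> is_derive t 1 (F ^~ x) (- re_ker t (x0 - x)).
  exact: is_derive_atan_div.
have Iy : `](y / 2), (2 * y)[%classic y by rewrite /= in_itv/=; apply/andP; split; lra.
have I0 t : `](y / 2), (2 * y)[%classic t -> 0 < t.
  by rewrite /= in_itv/= => /andP[h _]; lra.
have p1E (t x : R) : 0 < t -> partial1of2 F t x = - re_ker t (x0 - x).
  by move=> t0; rewrite partial1of2E; have := d1 t x t0 => ?; rewrite derive_val.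
(* For heights [t] in []y / 2, 2 * y[] the derivative of the integrand is at most [1 / t <= 2 / y],
   the constant dominating function. *)
have key := @cvg_differentiation_under_integral R _ _ mu F setT measurableT y
  (y / 2) (2 * y) Iy _ _ (cst (2 / y)) _ _ _.
have {}key := key
  (fun t _ => bounded_prob_integrable mu (measurable_atan_div x0 t) (fun x => atan_norm_le2 _)).
have {}key := key (fun t x It _ => @ex_derive _ _ _ _ _ _ _ (d1 t x (I0 t It))).
have {}key : (h^-1 *: (atan_transform mu x0 (h + y) - atan_transform mu x0 y))
    @[h --> 0^'] --> \int[mu]_x partial1of2 F y x.
  apply: key.
  - by move=> x; rewrite divr_ge0// ltW.
  - by apply: (@bounded_prob_integrable _ _ _ `|2 / y|).
  - move=> t x It _; have t0 := I0 t It; rewrite p1E// normrN.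
    rewrite (le_trans (norm_re_ker_le _ t0))//.
    rewrite /= -[leRHS]invrK lef_pV2 ?posrE ?invr_gt0 ?divr_gt0// invf_div.
    by move: It; rewrite /= in_itv/= => /andP[/ltW].
have -> : (- \int[mu]_x re_ker y (x0 - x)) = (\int[mu]_x partial1of2 F y x).
  rewrite -mulN1r -RintegralZl//; last first.
    apply: (@bounded_prob_integrable _ _ _ y^-1); first exact: measurable_re_ker.
    by move=> x; exact: norm_re_ker_le.
  by apply: eq_Rintegral => x _; rewrite p1E// mulN1r.
have E : (fun h => h^-1 *: (atan_transform mu x0 (h + y) - atan_transform mu x0 y)) =
    (fun h => h^-1 *: ((atan_transform mu x0 \o shift y) (h *: (1 : R)) -
      atan_transform mu x0 y)).
  by apply/funext => h; rewrite /= [h%:A]mulr1.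
apply: DeriveDef.
  by apply/cvg_ex; eexists; rewrite /= -E; exact: key.
by rewrite /derive -E; apply/cvg_lim; [exact: Rhausdorff|exact: key].
Qed.

(** Dominated convergence with the constant [pi / 2]; convergence along integer heights suffices to
    remove the boundary term at infinity. *)
Lemma atan_transform_cvg0 mu (x0 : R) :
  atan_transform mu x0 n.+1%:R @[n --> \oo] --> (0 : R).
Proof.
pose f_ (n : nat) (x : R) : \bar R := (atan ((x0 - x) / n.+1%:R))%:E.
have mf_ n : measurable_fun setT (f_ n).
  apply/measurable_EFinP; exact: measurable_atan_div.
have f_0 (x : R) : setT x -> f_ ^~ x @ \oo --> (cst 0%E : R -> \bar R) x.
  move=> _; apply: cvg_EFin; first exact: nearW.
  have : (x0 - x) * harmonic n @[n --> \oo] --> (x0 - x) * 0.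
    by apply: cvgM; [exact: cvg_cst|exact: cvg_harmonic].
  rewrite mulr0 => cv.
  have := cvg_comp _ _ cv (@continuous_atan R 0).
  by rewrite atan0; exact.
have ig : mu.-integrable setT (EFin \o cst (pi / 2 : R)).
  by apply: (@bounded_prob_integrable _ _ _ `|pi / 2|).
have f_le (x : R) : forall n, setT x -> (`|f_ n x| <= (EFin \o cst (pi / 2 : R)%R) x)%E.
  by move=> n _; rewrite lee_fin; exact: atan_norm_le2.
have [_ _ key] := dominated_convergence measurableT mf_ (measurable_cst 0%E)
  (aeW _ f_0) ig (aeW _ f_le).
have key' : (\int[mu]_x f_ n x)%E @[n --> \oo] --> 0%E.
  by move: key; rewrite integral0.
exact: fine_cvg key'.
Qed.

End AtanTransform.

Section Sandwich.
Context {R : realType}.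
Implicit Types mu : probability R R.

(** [g - f] and [g + f] have nonnegative derivatives, hence do not decrease from [u] to [v], by the
    mean value theorem. *)
Lemma is_derive_dominated (f f' g g' : R -> R) (u v : R) : u <= v ->
  (forall x, u <= x <= v -> is_derive x 1 f (f' x)) ->
  (forall x, u <= x <= v -> is_derive x 1 g (g' x)) ->
  (forall x, u <= x <= v -> `|f' x| <= g' x) ->
  `|f v - f u| <= g v - g u.
Proof.
rewrite le_eqVlt => /predU1P[-> _ _ _|uv df dg fg].
  by rewrite !subrr normr0.
have main (h h' : R -> R) : (forall x, u <= x <= v -> is_derive x 1 h (h' x)) ->
    (forall x, u <= x <= v -> 0 <= h' x) -> h u <= h v.
  move=> dh h0.
  have cd x : x \in `]u, v[ -> u <= x <= v.
    by rewrite in_itv/= => /andP[/ltW -> /ltW ->].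
  have ch : {within `[u, v], continuous h}.
    apply: derivable_within_continuous => x; rewrite in_itv/= => xuv.
    by have [] := dh x xuv.
  have [z zuv E] := MVT uv (fun x xuv => dh x (cd x xuv)) ch.
  by rewrite -subr_ge0 E mulr_ge0 ?subr_ge0 ?(ltW uv)// h0// cd.
have h1 := main (fun x => g x - f x) (fun x => g' x - f' x).
have h2 := main (fun x => g x + f x) (fun x => g' x + f' x).
have {}h1 : g u - f u <= g v - f v.
  apply: h1 => x xuv.
    by have := df x xuv; have := dg x xuv => ? ?; exact: is_deriveB.
  by have := fg x xuv; rewrite ler_norml => /andP[]; lra.
have {}h2 : g u + f u <= g v + f v.
  apply: h2 => x xuv.
    by have := df x xuv; have := dg x xuv => ? ?; exact: is_deriveD.
  by have := fg x xuv; rewrite ler_norml => /andP[]; lra.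
by rewrite ler_norml; apply/andP; split; lra.
Qed.

Lemma norm_atan_le (x : R) : `|atan x| <= `|x|.
Proof.
have := @is_derive_le_lipschitz R atan (fun x => (1 + x ^+ 2)^-1) 1 (@is_derive1_atan R) _ x 0.
rewrite atan0 !subr0 mul1r; apply => z.
rewrite ger0_norm ?invr_ge0 ?addr_ge0 ?sqr_ge0//.
by rewrite invf_le1 ?ltr_wpDr ?sqr_ge0// lerDl sqr_ge0.
Qed.

Lemma atan_inv (x : R) : 0 < x -> pi / 2 - atan x = atan x^-1.
Proof.
move=> x0; have a0 : 0 < atan x by rewrite -(@atan0 R) lt_atan.
have a1 := atan_ltpi2 x.
rewrite -[LHS]tanK; last by rewrite in_itv/=; apply/andP; split; lra.
congr atan.
rewrite /tan sinB cosB cos_pihalf sin_pihalf !mul0r !mul1r subr0 add0r.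
by rewrite -[in RHS](atanK x) /tan invf_div.
Qed.

(** The sign of [x0 - x], with value [1] at [x = x0] because [trans_cumul] counts the atom at
    [x0]. *)
Definition step (x0 x : R) : R := if x <= x0 then 1 else -1.

(** Away from [x0] the gap is [atan (k / |x0 - x|)], at most its argument; the product form also
    covers [x = x0]. *)
Lemma atan_step_le (x0 x k : R) : 0 < k ->
  `|atan ((x0 - x) / k) - pi / 2 * step x0 x| * `|x0 - x| <= k.
Proof.
move=> k0; rewrite /step; case: (ltgtP x x0) => [xx0|xx0|->]; last first.
- by rewrite subrr normr0 mulr0 ltW.
- have s0 : 0 < (x - x0) / k by rewrite divr_gt0// subr_gt0.
  have -> : (x0 - x) / k = - ((x - x0) / k) by field; rewrite gt_eqF.
  rewrite atanN mulrN1 opprK addrC atan_inv// distrC.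
  rewrite -ler_pdivlMr ?normr_gt0 ?subr_eq0 ?gt_eqF//.
  rewrite (le_trans (norm_atan_le _))// invf_div normrM normfV.
  by rewrite (gtr0_norm k0).
- have s0 : 0 < (x0 - x) / k by rewrite divr_gt0// subr_gt0.
  rewrite mulr1 distrC atan_inv// -ler_pdivlMr ?normr_gt0 ?subr_eq0 ?gt_eqF//.
  rewrite (le_trans (norm_atan_le _))// invf_div normrM normfV.
  by rewrite (gtr0_norm k0).
Qed.

(** The arctangent vanishes or has the sign of [step], so the gap is at most [pi / 2 < 2]. *)
Lemma atan_step_le2 (x0 x k : R) : 0 < k ->
  `|atan ((x0 - x) / k) - pi / 2 * step x0 x| <= 2.
Proof.
move=> k0; have p2 := pihalf_lt2 R.
have b1 := atan_ltpi2 ((x0 - x) / k); have b2 := atan_gtNpi2 ((x0 - x) / k).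
rewrite /step; case: (leP x x0) => xx0.
  have a0 : 0 <= atan ((x0 - x) / k).
    by rewrite -(@atan0 R) le_atan// divr_ge0 ?subr_ge0// ltW.
  by rewrite ler_norml; apply/andP; split; lra.
have a0 : atan ((x0 - x) / k) <= 0.
  by rewrite -(@atan0 R) le_atan// ler_pdivrMr// mul0r subr_le0 ltW.
by rewrite ler_norml; apply/andP; split; lra.
Qed.

(* Dyadic decomposition of [|x0 - x|] at the scales [2 ^ j * k]. *)
Lemma dyadic_bound (e s k : R) (n : nat) : 0 < k -> 0 <= e -> e <= 2 ->
  e * `|s| <= k -> 1 <= 2 ^+ n.+1 * k ->
  e <= 10 * k * \sum_(j < n.+1) im_ker (2 ^+ j * k) s + k.
Proof.
move=> k0 e0 e2 es nk.
have k10 : 0 <= 10 * k by rewrite mulr_ge0// ltW.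
have pow0 j : 0 < 2 ^+ j * k :> R by rewrite mulr_gt0// exprn_gt0.
have im_lower j : `|s| < 2 ^+ j.+1 * k -> (5 * (2 ^+ j * k))^-1 <= im_ker (2 ^+ j * k) s.
  move=> sj; have p0 := pow0 j; move: sj p0; rewrite exprS -mulrA; set p := 2 ^+ j * k.
  move=> sj p0; rewrite /im_ker -(real_normK (num_real s)).
  have sp : `|s| ^+ 2 <= (2 * p) ^+ 2.
    by rewrite ler_pXn2r ?nnegrE ?normr_ge0 ?ltW// mulr_gt0.
  rewrite -[leRHS]invrK lef_pV2 ?posrE ?mulr_gt0 ?invr_gt0 ?divr_gt0//; last first.
    by rewrite ltr_wpDl ?sqr_ge0 ?exprn_gt0.
  rewrite invf_div ler_pdivrMr//; rewrite exprMn in sp; lra.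
have sum_ge0 m : 0 <= \sum_(j < m) im_ker (2 ^+ j * k) s.
  by apply: sumr_ge0 => j _; rewrite ltW// im_ker_gt0.
(* In the innermost ball [e <= 2 = 10 * k / (5 * k)]. On the annulus from [p] to [2 * p],
   [e <= k / p], below the term of height [p], which is at least [2 * k / p]. *)
have main m : `|s| < 2 ^+ m.+1 * k -> e <= 10 * k * \sum_(j < m.+1) im_ker (2 ^+ j * k) s.
  elim: m => [|m IH] sm.
    rewrite big_ord_recl big_ord0 addr0/=.
    have := im_lower 0%N sm; rewrite expr0 mul1r => h.
    have : 10 * k * (5 * k)^-1 <= 10 * k * im_ker k s by rewrite ler_wpM2l// mulr_ge0// ltW.
    have -> : 10 * k * (5 * k)^-1 = 2 by field; rewrite gt_eqF.
    exact: le_trans.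
  rewrite big_ord_recr/= mulrDr.
  have [ms|ms] := leP (2 ^+ m.+1 * k) `|s|; last first.
    rewrite (le_trans (IH ms))// lerDl; apply: mulr_ge0 => //.
    exact/ltW/im_ker_gt0.
  have h := im_lower _ sm.
  apply: (@le_trans _ _ (10 * k * im_ker (2 ^+ m.+1 * k) s)); last first.
    by rewrite lerDr (mulr_ge0 k10)// sum_ge0.
  apply: (@le_trans _ _ (10 * k * (5 * (2 ^+ m.+1 * k))^-1)); last first.
    by rewrite ler_wpM2l// mulr_ge0// ltW.
  have p0 := pow0 m.+1; move: ms p0; set p := 2 ^+ m.+1 * k => ps p0.
  have -> : 10 * k * (5 * p)^-1 = 2 * k / p by field; rewrite gt_eqF.
  rewrite ler_pdivlMr//; have : e * p <= e * `|s| by rewrite ler_wpM2l.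
  by lra.
(* Beyond the last scale [|s| >= 1], so [e <= e * |s| <= k]: this is the final summand. *)
have [s1|s1] := ltP `|s| (2 ^+ n.+1 * k).
  by rewrite (le_trans (main n s1))// lerDl ltW.
apply: (@le_trans _ _ k); last by rewrite lerDr (mulr_ge0 k10)// sum_ge0.
apply: le_trans es; rewrite ler_peMr//; exact: le_trans s1.
Qed.

End Sandwich.

(** * Quantitative comparison of cumulative functions *)

Section Kolmogorov.
Context {R : realType}.
Implicit Types mu : probability R R.
Local Notation leb := (@lebesgue_measure R).

Lemma stepE (x0 : R) : step x0 = (fun x => 2 * \1_[set x : R | x <= x0] x - 1).
Proof.
apply/funext => x; rewrite /step indicE.
case: (leP x x0) => xx0; first by rewrite mem_set//= mulr1; ring.
by rewrite memNset/= ?mulr0 ?sub0r// leNgt xx0.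
Qed.

Lemma measurable_le_set (x0 : R) : measurable [set x : R | x <= x0].
Proof.
rewrite (_ : [set x : R | x <= x0] = `]-oo, x0]%classic); first exact: measurable_itv.
by apply/seteqP; split => x /=; rewrite in_itv.
Qed.

Lemma measurable_step (x0 : R) : measurable_fun setT (step x0).
Proof.
rewrite stepE; apply: measurable_funB => //; apply: measurable_funM => //.
exact: measurable_indic (measurable_le_set x0).
Qed.

Lemma Rintegral_step mu (x0 : R) : \int[mu]_x step x0 x = 2 * trans_cumul mu x0 - 1.
Proof.
have mA := measurable_le_set x0.
have iA : mu.-integrable setT (EFin \o (\1_[set x : R | x <= x0] : R -> R)).
  apply: (@bounded_prob_integrable _ _ _ 1); first exact: measurable_indic.
  by move=> x; rewrite indicE; case: (_ \in _); rewrite ?normr1 ?normr0.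
have i1 : mu.-integrable setT (EFin \o cst (1 : R)).
  exact: (@bounded_prob_integrable _ _ _ `|1|).
rewrite stepE RintegralB//; last exact: integrableZl_EFin.
rewrite RintegralZl// (Rintegral_prob_cst mu 1) /Rintegral integral_indic// setIT.
by [].
Qed.

Lemma Rintegral_sum_ord mu (m : nat) (F : nat -> R -> R) :
  (forall j, mu.-integrable setT (EFin \o F j)) ->
  mu.-integrable setT (EFin \o (fun x => \sum_(j < m) F j x)) /\
  \int[mu]_x (\sum_(j < m) F j x) = \sum_(j < m) \int[mu]_x F j x.
Proof.
move=> iF; elim: m => [|m [im IH]].
  split.
    rewrite (_ : (fun x => _) = cst (0 : R)).
      apply: (@bounded_prob_integrable _ mu (cst (0 : R)) 0) => // x.
      by rewrite /= normr0.
    by apply/funext => x; rewrite big_ord0.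
  rewrite big_ord0; under eq_Rintegral do rewrite big_ord0.
  exact: (Rintegral_prob_cst mu 0).
have E : (fun x => \sum_(j < m.+1) F j x) = (fun x => \sum_(j < m) F j x + F m x).
  by apply/funext => x; rewrite big_ord_recr.
split; first by rewrite E; exact: integrableD_EFin.
by rewrite E RintegralD// IH big_ord_recr.
Qed.

(** Integrate [dyadic_bound] against [mu]: each of the [n + 1] scales contributes at most [C], so
    the cost is [k] times the number of scales. *)
Lemma atan_cumul_close mu (x0 k C : R) (n : nat) : 0 < k -> 1 <= 2 ^+ n.+1 * k ->
  (forall j, (j <= n)%N -> \int[mu]_x im_ker (2 ^+ j * k) (x0 - x) <= C) ->
  `|atan_transform mu x0 k - pi / 2 * (2 * trans_cumul mu x0 - 1)| <=
  10 * k * (C * n.+1%:R) + k.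
Proof.
move=> k0 nk imC.
have pow0 j : 0 < 2 ^+ j * k :> R by rewrite mulr_gt0// exprn_gt0.
have iat : mu.-integrable setT (EFin \o (fun x => atan ((x0 - x) / k))).
  apply: (@bounded_prob_integrable _ _ _ (pi / 2)); first exact: measurable_atan_div.
  by move=> x; exact: atan_norm_le2.
have ist : mu.-integrable setT (EFin \o step x0).
  apply: (@bounded_prob_integrable _ _ _ 1); first exact: measurable_step.
  by move=> x; rewrite /step; case: ifP; rewrite ?normrN normr1.
have ist2 : mu.-integrable setT (EFin \o (fun x => pi / 2 * step x0 x)).
  exact: integrableZl_EFin.
have idf := integrableB_EFin measurableT iat ist2.
have iF j : mu.-integrable setT (EFin \o (fun x => im_ker (2 ^+ j * k) (x0 - x))).
  apply: (@bounded_prob_integrable _ _ _ (2 ^+ j * k)^-1).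
    exact: measurable_im_ker.
  by move=> x; rewrite ger0_norm ?im_ker_le// ltW// im_ker_gt0.
have [isum sumE] := Rintegral_sum_ord n.+1 iF.
rewrite -Rintegral_step -RintegralZl// /atan_transform -RintegralB//.
apply: (le_trans (le_normr_Rintegral _ idf)) => //.
have ic : mu.-integrable setT (EFin \o cst k).
  exact: (@bounded_prob_integrable _ _ _ `|k|).
have isum10 := integrableZl_EFin measurableT (10 * k) isum.
apply: (@le_trans _ _ (\int[mu]_x
  (10 * k * (\sum_(j < n.+1) im_ker (2 ^+ j * k) (x0 - x)) + cst k x))).
  apply: le_Rintegral => //; first exact: integrable_norm.
    exact: integrableD_EFin.
  move=> x _; apply: dyadic_bound => //; first exact: atan_step_le2.
  exact: atan_step_le.
rewrite RintegralD// Rintegral_prob_cst lerD2r RintegralZl//.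
rewrite ler_wpM2l ?mulr_ge0 ?(ltW k0)// sumE.
rewrite mulr_natr -[leRHS](_ : \sum_(j < n.+1) C = _); last first.
  by rewrite sumr_const card_ord.
by apply: ler_sum => j _; apply: imC; rewrite -ltnS.
Qed.


Lemma ln2_ge : 1 / 2 <= ln (2 : R).
Proof.
rewrite -ler_expR lnK ?posrE//.
have := @expR_near1 R (1 / 2) (1 / 2); rewrite ger0_norm// => /(_ (lexx _) (lexx _)).
by rewrite ler_norml => /andP[_]; lra.
Qed.

(** Take the least [n] reaching [1]; minimality keeps all heights [2 ^ j * k], [j <= n], at most
    [1], and logarithms with [ln 2 >= 1 / 2] bound [n]. *)
Lemma dyadic_scale (k : R) : 0 < k -> k < 1 ->
  exists n : nat, [/\ 1 <= 2 ^+ n.+1 * k, 2 ^+ n * k <= 1 & n%:R <= 2 * - ln k].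
Proof.
move=> k0 k1.
have ex : exists n : nat, 1 <= 2 ^+ n.+1 * k.
  exists (Num.bound k^-1); rewrite -ler_pdivrMr// div1r.
  rewrite (le_trans (ltW (archi_boundP _)))// ?invr_ge0 ?(ltW k0)//.
  by rewrite -natrX ler_nat (leq_trans (ltnW (ltn_expl _ (ltnSn 1))))// leq_exp2l.
case: (ex_minnP ex) => n nk nmin; exists n.
have k2 : 2 ^+ n * k <= 1.
  case: n nk nmin => [|n] nk nmin; first by rewrite expr0 mul1r ltW.
  by rewrite leNgt; apply/negP => /ltW /nmin; rewrite ltnn.
split => //.
have : ln (2 ^+ n * k) <= 0 by exact: ln_le0.
rewrite lnM ?posrE ?exprn_gt0// lnXn//.
have := ln2_ge; have : 0 <= n%:R :> R by [].
rewrite -[ln 2 *+ n]mulr_natr => n0 l2.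
have : 1 / 2 * n%:R <= ln 2 * n%:R :> R by rewrite ler_wpM2r.
by lra.
Qed.

(* [|Phi'| <= C eps / y] near the real line costs the logarithm, while
   [|Phi'| <= C eps / y ^ 2] handles the neighbourhood of infinity. *)
Lemma kolmogorov_bound (Omega : R -> R) muOmega (a a0 b0 b delta : R)
    (f : R -> R) (M : R) :
  continual_diagram Omega -> transition_measure Omega muOmega ->
  a < a0 -> a0 < b0 -> b0 < b -> 0 < delta ->
  (forall x y, a <= x <= b -> a <= y <= b ->
       `|Omega x - Omega y| <= (1 - delta) * `|x - y|) ->
  measurable_fun [set x : R | a <= x <= b] f ->
  (forall x, a <= x <= b -> 0 <= f x <= M) ->
  (forall A : set R, measurable A -> A `<=` [set x : R | a <= x <= b] ->
     (muOmega A = \int[leb]_(x in A) (f x)%:E)%E) ->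
  exists2 C : R, 0 < C & forall (w : R -> R) mu (eps x0 : R),
    continual_diagram w -> transition_measure w mu ->
    0 < eps -> 2 * pi * eps < 1 -> (forall v, `|w v - Omega v| <= 2 * eps) ->
    a0 <= x0 <= b0 ->
    `|trans_cumul mu x0 - trans_cumul muOmega x0| <=
      C * eps * (1 - ln (2 * pi * eps)).
Proof.
move=> cO tO aa0 ab0 bb0 d0 lipO mf fM muE.
have [C C0 key] := cauchy_comparison cO tO aa0 ab0 bb0 d0 lipO mf fM muE.
have pi0 := pi_gt0 R; have pi2 := pi_ge2 R.
(* [C] comes from the difference of the transforms at height [k]; the rest is twice
   [40 * pi * C + 2 * pi], the smoothing error of each measure, as [k = 2 * pi * eps] and there are
   at most [2 * (1 + l)] scales. *)
exists (C + 80 * pi * C + 4 * pi).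
  by have := mulr_gt0 pi0 C0; lra.
move=> w mu eps x0 cw tw eps0 k1 wO x0ab.
set k := 2 * pi * eps in k1 *.
have k0 : 0 < k by rewrite !mulr_gt0.
have {}key y := key w mu eps x0 y cw tw eps0 wO x0ab.
pose Phi y := atan_transform mu x0 y - atan_transform muOmega x0 y.
pose Phi' y := - (\int[mu]_x re_ker y (x0 - x)) - - (\int[muOmega]_x re_ker y (x0 - x)).
have dPhi (y : R) : 0 < y -> is_derive y 1 Phi (Phi' y).
  move=> y0; have := is_derive_atan_transform mu x0 y0.
  by have := is_derive_atan_transform muOmega x0 y0 => ? ?; exact: is_deriveB.
have Phi'E y : `|Phi' y| =
    `|\int[mu]_x re_ker y (x0 - x) - \int[muOmega]_x re_ker y (x0 - x)|.
  by rewrite -normrN; congr `|_|; rewrite /Phi'; ring.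
pose l := - ln k.
have l0 : 0 <= l by rewrite oppr_ge0 ln_le0// ltW.
have near_axis : `|Phi 1 - Phi k| <= C * eps * l.
  have -> : C * eps * l = C * eps * ln 1 - C * eps * ln k by rewrite ln1 /l; ring.
  apply: (is_derive_dominated (f' := Phi') (g := fun y => C * eps * ln y)
    (g' := fun y => C * eps / y) (ltW k1)).
  - by move=> y /andP[ky _]; apply: dPhi; exact: lt_le_trans ky.
  - move=> y /andP[ky _]; have y0 : 0 < y by exact: lt_le_trans ky.
    have := is_derive1_ln y0 => dl.
    by apply: is_derive_eq; rewrite /GRing.scale/=; ring.
  - by move=> y /andP[ky y1]; rewrite Phi'E; have [_ _ + _] := key y ky; exact.
(* The primitive [- C * eps / y] is bounded near infinity, which makes the estimate uniform in
   [n]. *)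
have far (n : nat) : `|Phi n.+1%:R - Phi 1| <= C * eps.
  have n1 : 1 <= n.+1%:R :> R by rewrite ler1n.
  have dom : `|Phi n.+1%:R - Phi 1| <=
      - (C * eps / n.+1%:R) - - (C * eps / 1).
    apply: (is_derive_dominated (f' := Phi') (g := fun y : R => - (C * eps / y))
      (g' := fun y => C * eps / y ^+ 2) n1).
    - by move=> y /andP[y1 _]; apply: dPhi; exact: lt_le_trans y1.
    - move=> y /andP[y1 _]; have y0 : 0 < y by exact: lt_le_trans y1.
      have yn : y != 0 by rewrite gt_eqF.
      have := is_deriveV (f := fun y : R => y) yn (is_derive_id y 1) => dV.
      by apply: is_derive_eq; rewrite /GRing.scale/=; field.
    - move=> y /andP[y1 _]; rewrite Phi'E.
      by have [_ _ _] := key y (le_trans (ltW k1) y1).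
  apply: (le_trans dom); rewrite divr1 opprK gerDr oppr_le0.
  by rewrite divr_ge0// mulr_ge0// ltW.
have Phi1 : `|Phi 1| <= C * eps.
  have cv : `|Phi n.+1%:R - Phi 1| @[n --> \oo] --> `|0 - 0 - Phi 1|.
    apply: cvg_norm; apply: cvgB; last exact: cvg_cst.
    by apply: cvgB; exact: atan_transform_cvg0.
  rewrite -normrN -(add0r (- _)) -[X in X - _](subrr 0).
  by apply: (cvgr_to_le cv); apply: nearW => n; exact: far.
have [n [nk nk1 nl]] := dyadic_scale k0 k1.
have scale j : (j <= n)%N -> k <= 2 ^+ j * k <= 1.
  move=> jn; rewrite ler_peMl ?(ltW k0) ?exprn_ege1 ?ler1n//=.
  by rewrite (le_trans _ nk1)// ler_wpM2r ?(ltW k0)// ler_weXn2l ?ler1n.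
have cO1 := @atan_cumul_close muOmega x0 k C n k0 nk _.
have cw1 := @atan_cumul_close mu x0 k C n k0 nk _.
have {}cO1 := cO1 (fun j jn => ltac:(
  have /andP[kj kj1] := scale j jn; have [+ _ _ _] := key _ kj; exact)).
have {}cw1 := cw1 (fun j jn => ltac:(
  have /andP[kj kj1] := scale j jn; have [_ + _ _] := key _ kj; exact)).
have Phik : `|Phi k| <= C * eps * l + C * eps.
  have -> : Phi k = - (Phi 1 - Phi k) + Phi 1 by ring.
  by rewrite (le_trans (ler_normD _ _))// normrN lerD.
set Kw := trans_cumul mu x0 in cw1 *; set KO := trans_cumul muOmega x0 in cO1 *.
have err : 10 * k * (C * n.+1%:R) + k <= eps * (1 + l) * (40 * pi * C + 2 * pi).
  have n1l : n.+1%:R <= 2 * (1 + l) by rewrite -natr1 /l; lra.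
  have : 10 * k * (C * n.+1%:R) <= 10 * k * (C * (2 * (1 + l))).
    apply: ler_wpM2l; first by apply: mulr_ge0 => //; exact: ltW.
    by apply: ler_wpM2l => //; exact: ltW.
  have -> : 10 * k * (C * (2 * (1 + l))) = eps * (1 + l) * (40 * pi * C) by rewrite /k; ring.
  have : k <= eps * (1 + l) * (2 * pi).
    have : 0 <= 2 * pi * eps * l by rewrite mulr_ge0// ltW.
    by rewrite /k; lra.
  by lra.
(* [pi * (Kw - KO)] is [Phi k] corrected by the smoothing errors of the two measures at height
   [k]. *)
have tri : pi * `|Kw - KO| <= `|Phi k| + (10 * k * (C * n.+1%:R) + k) *+ 2.
  rewrite -[X in X * _](gtr0_norm pi0) -normrM.
  have -> : pi * (Kw - KO) = Phi k -
      (atan_transform mu x0 k - pi / 2 * (2 * Kw - 1)) +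
      (atan_transform muOmega x0 k - pi / 2 * (2 * KO - 1)).
    by rewrite /Phi; field.
  apply: (le_trans (ler_normD _ _)); rewrite mulr2n (addrA `|Phi k|).
  apply: lerD => //; apply: (le_trans (ler_normB _ _)); exact: lerD.
rewrite -(ler_pM2l pi0).
apply: (le_trans tri); rewrite mulr2n -/l.
have B0 : 0 <= eps * (1 + l) * (C + 80 * pi * C + 4 * pi).
  apply: mulr_ge0; first by apply: mulr_ge0; lra.
  by have := mulr_gt0 pi0 C0; lra.
have : eps * (1 + l) * (C + 80 * pi * C + 4 * pi) <=
    pi * (eps * (1 + l) * (C + 80 * pi * C + 4 * pi)).
  by rewrite ler_peMl//; lra.
by lra.
Qed.

End Kolmogorov.

(** * Distance between diagrams and asymptotics *)

Section DiagDist.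
Context {R : realType}.

(** Compare [v] with far points [z] and [- z], where [w] equals [z]: the 1-Lipschitz bound gives
    [w v >= v] and [w v >= - v]. *)
Lemma diagram_ge_norm (w : R -> R) (v : R) : continual_diagram w -> `|v| <= w v.
Proof.
move=> [_ [lip [M wM]]].
pose z : R := `|M| + `|v|.
have z0 : 0 <= z by rewrite addr_ge0.
have Mz : M <= z by rewrite (le_trans (ler_norm M))// lerDl.
have vz : `|v| <= z by rewrite lerDr.
have w1 : w z = z by rewrite wM ger0_norm.
have w2 : w (- z) = z by rewrite wM normrN ger0_norm.
have := lip v z; have := lip v (- z); rewrite w1 w2.
move: vz; rewrite ler_norml => /andP[vz1 vz2].
rewrite (ger0_norm (_ : 0 <= v - - z)) ?(ler0_norm (_ : v - z <= 0)); [|lra..].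
rewrite !ler_norml => /andP[h1 h2] /andP[h3 h4].
by apply/andP; split; lra.
Qed.

(** The point of the graph of [w1] above [v] has coordinates [(x, y)]; moving [y] by about [eps] to
    [z] reaches the graph of [w2]. Passing from [x - z] back to [v] costs [|y - z|], and so does
    replacing [x + z] by [x + y]: hence the factor [2]. *)
Lemma diag_dist_close (w1 w2 : R -> R) (eps v : R) :
  continual_diagram w1 -> continual_diagram w2 ->
  (diag_dist w1 w2 <= eps%:E)%E -> `|w2 v - w1 v| <= 2 * eps.
Proof.
move=> c1 c2 dist.
have := diagram_ge_norm v c1; rewrite ler_norml => /andP[v1 v2].
pose x := (w1 v + v) / 2; pose y := (w1 v - v) / 2.
have x0 : 0 <= x by rewrite /x; lra.
have y0 : 0 <= y by rewrite /y; lra.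
have xyv : x - y = v by rewrite /x /y; field.
have xyw : x + y = w1 v by rewrite /x /y; field.
have Yy : PiY w1 x y by split => //; rewrite xyv xyw.
have dY_le : (dist_to_set y (PiY w2 x) <= eps%:E)%E.
  apply: le_trans dist; apply: (@le_trans _ _ (dY w1 w2)); last first.
    by rewrite /diag_dist le_max lexx orbT.
  apply: (@le_trans _ _ (hausdorff (PiY w1 x) (PiY w2 x))); last first.
    by apply: ereal_sup_ubound; exists x.
  rewrite /hausdorff le_max; apply/orP; left.
  by apply: ereal_sup_ubound; exists y.
(* The slack [e] yields a point [z] nearly realizing the infimum in [dist_to_set]. *)
apply/ler_addgt0Pr => e e0.
have : (dist_to_set y (PiY w2 x) < (eps + e / 2)%:E)%E.
  by apply: le_lt_trans dY_le _; rewrite lte_fin ltrDl divr_gt0.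
move=> /ereal_inf_lt[_ [z [z0 w2z] <-]]; rewrite lte_fin => yz.
have [_ [lip2 _]] := c2.
have l2 := lip2 v (x - z).
have E : v - (x - z) = - (y - z) by rewrite -xyv; ring.
rewrite E normrN w2z in l2.
have -> : w2 v - w1 v = (w2 v - (x + z)) - (y - z) by rewrite -xyw; ring.
apply: (le_trans (ler_normB _ _)).
apply: (le_trans (lerD l2 (lexx _))).
by move: yz; set t := `|y - z|; lra.
Qed.

(** With [l = ln n], the factor [1 - ln (2 * pi * e)] is [1 - ln (2 * pi * eta) + alpha * l + ln l],
    at most [(alpha + 2) * l] for large [n]. This cancels the logarithm in [e], and [eta] is chosen
    so that [C * eta * (alpha + 2) = eps]. *)
Lemma small_log_error (C alpha eps : R) : 0 < C -> 0 < alpha -> 0 < eps ->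
  exists2 eta : R, 0 < eta & exists N : nat, forall n : nat, (N <= n)%N ->
    let e := eta / ((n%:R : R) `^ alpha * ln (n%:R : R)) in
    [/\ (1 <= n)%N, 0 < e, 2 * pi * e < 1 &
        C * e * (1 - ln (2 * pi * e)) <= eps / (n%:R : R) `^ alpha].
Proof.
move=> C0 al0 eps0; have pi0 := pi_gt0 R.
pose eta := eps / (C * (alpha + 2)).
have al2 : 0 < alpha + 2 by lra.
have eta0 : 0 < eta by rewrite divr_gt0// mulr_gt0.
exists eta => //.
(* Once [ln n >= T], the logarithm exceeds [1], absorbs the constant [1 - ln (2 * pi * eta)] and
   forces [2 * pi * e < 1]. *)
pose T : R := 1 + `|1 - ln (2 * pi * eta)| + 2 * pi * eta.
have peta : 0 < 2 * pi * eta by apply: mulr_gt0 => //; exact: mulr_gt0.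
exists (Num.bound (expR T)).+1 => n nN e.
have n1 : (1 <= n)%N by apply: leq_trans nN.
have n0 : 0 < n%:R :> R by rewrite ltr0n.
have lnT : T <= ln n%:R.
  rewrite -ler_expR lnK ?posrE//.
  rewrite (le_trans (ltW (archi_boundP (expR_ge0 T))))// ler_nat.
  exact: ltnW.
set l := ln n%:R in lnT e *.
have n1l := normr_ge0 (1 - ln (2 * pi * eta)).
have l1 : 1 <= l by rewrite /T in lnT; lra.
have l0 : 0 < l by lra.
pose p := (n%:R : R) `^ alpha.
have p1 : 1 <= p.
  by have := @ler_powR R n%:R _ 0 alpha (ltW al0); rewrite powRr0 ler1n; exact.
have p0 : 0 < p by lra.
have e0 : 0 < e by rewrite divr_gt0// mulr_gt0.
have pl : l <= p * l by rewrite ler_peMl// ltW.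
have eE : e = eta / (p * l) by [].
split => //.
  rewrite eE mulrA ltr_pdivrMr ?mulr_gt0// mul1r; rewrite /T in lnT; lra.
have ln_div3 (s t u : R) : 0 < s -> 0 < t -> 0 < u ->
    ln (s / (t * u)) = ln s - ln t - ln u.
  move=> s0 t0 u0; rewrite ln_div ?posrE ?mulr_gt0// lnM ?posrE//; ring.
have lnE : ln (2 * pi * e) = ln (2 * pi * eta) - alpha * l - ln l.
  by rewrite eE mulrA ln_div3// /p ln_powR.
have lnl := ln_sublinear l0.
have bound : 1 - ln (2 * pi * e) <= (alpha + 2) * l.
  rewrite lnE; have := ler_norm (1 - ln (2 * pi * eta)).
  by rewrite /T in lnT; lra.
apply: (@le_trans _ _ (C * e * ((alpha + 2) * l))).
  by rewrite ler_wpM2l// mulr_ge0// ltW.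
rewrite le_eqVlt; apply/orP; left; apply/eqP.
rewrite eE /eta -/p; field.
by rewrite !gt_eqF.
Qed.

End DiagDist.

Theorem mainTheorem1 (R : realType) (alpha : R) (Omega : R -> R)
  (muOmega : probability R R) (a a0 b0 b : R)
  (omega : nat -> R -> R) (mu : nat -> probability R R) :
  0 < alpha ->
  continual_diagram Omega ->
  transition_measure Omega muOmega ->
  a < a0 -> a0 < b0 -> b0 < b ->
  (* (i) Omega restricted to [a,b] is (1 - delta)-Lipschitz, delta > 0 *)
  (exists delta : R, 0 < delta /\
     forall x y, a <= x <= b -> a <= y <= b ->
       `|Omega x - Omega y| <= (1 - delta) * `|x - y|) ->
  (* (ii) muOmega restricted to [a,b] is absolutely continuous with a
     density bounded from above *)
  (exists (f : R -> R) (M : R),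
     measurable_fun [set x : R | a <= x <= b] f /\
     (forall x, a <= x <= b -> 0 <= f x <= M) /\
     (forall A : set R, measurable A -> A `<=` [set x : R | a <= x <= b] ->
        (muOmega A = \int[@lebesgue_measure R]_(x in A) (f x)%:E)%E)) ->
  (forall n : nat, (1 <= n)%N ->
     continual_diagram (omega n) /\ transition_measure (omega n) (mu n)) ->
  (* d(Omega, omega_n) = o(1 / (n^alpha log n)) *)
  (forall eps : R, 0 < eps -> exists N : nat, forall n : nat, (N <= n)%N ->
     (diag_dist Omega (omega n) <=
        (eps / ((n%:R : R) `^ alpha * ln (n%:R : R)))%:E)%E) ->
  (* sup_{z in [a0,b0]} |K_{omega_n}(z) - K_Omega(z)| = o(1 / n^alpha) *)
  forall eps : R, 0 < eps -> exists N : nat, forall n : nat, (N <= n)%N ->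
    forall z : R, a0 <= z <= b0 ->
      `|trans_cumul (mu n) z - trans_cumul muOmega z| <= eps / (n%:R : R) `^ alpha.
Proof.
move=> alpha0 cO tO aa0 ab0 bb0 [delta [d0 lipO]] [f [M [mf [fM muE]]]] cw dist eps eps0.
have [C C0 bound] := kolmogorov_bound cO tO aa0 ab0 bb0 d0 lipO mf fM muE.
have [eta eta0 [N1 small]] := small_log_error C0 alpha0 eps0.
have [N2 close] := dist eta eta0.
exists (maxn N1 N2) => n; rewrite geq_max => /andP[nN1 nN2] z zab.
have [n1 e0 e1 err] := small n nN1.
have [cwn twn] := cw n n1.
(* The bound is used with its [eps] equal to [eta / (n ^ alpha * ln n)], the bound on the distance
   provided by [close]. *)
apply: le_trans err; apply: (bound (omega n)) => //.
by move=> v; exact: diag_dist_close (close n nN2).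
Qed.
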